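(* There is a randomized implementation of a (linearizable) TAS object for $n$ processes from $\Theta(n)$ registers whose max-step complexity against any strong adaptive adversary is $O(\log k)$, both in expectation and with probability $1-k^{-\Omega(1)}$, where $k$ is the max-contention of the $\mathrm{TAS}()$ operation.
   Context: Model. There are $n$ processes with IDs $1,\dots,n$ in an asynchronous shared-memory system communicating via atomic multi-reader multi-writer read/write registers. Algorithms are randomized, using private local coin flips. An adversary is a function mapping each finite execution to the ID of the process taking the next step; a strong adaptive adversary may be any such function (it sees the whole past including coin-flip outcomes). Algorithm $M$, adversary $A$ and a random coin-flip vector yield a random execution $\mathcal E_{M,A}$. A TAS object stores a bit, initially $0$, and supports a one-time operation $\mathrm{TAS}()$ (each process calls it at most once) that sets the bit and returns its previous value; the implementation must be linearizable. Complexity. For an execution $\mathcal E$ of an algorithm $M$ using the object, let $T_p(\mathcal E)$ be the number of shared-memory steps $p$ takes in its $\mathrm{TAS}()$ call; let $\mathcal E'$ be the prefix ending when the first process becomes poised to invoke $\mathrm{TAS}()$; the max-contention $k$ is the maximum number of processes invoking $\mathrm{TAS}()$ in any execution of $M$ extending $\mathcal E'$. Expected max-step complexity $\le b(k)$ means $\mathbb E[\max_p T_p(\mathcal E_{M,A})\mid \mathcal E_{M,A}\text{ extends }\mathcal E']\le b(k)$ for all algorithms $M$, adversaries $A$ of the model, and prefixes $\mathcal E'$ arising under $A$ with max-contention at most $k$; ''max-step complexity $\le b(k)$ with probability $q(k)$'' means the corresponding conditional probability that $\max_p T_p\le b(k)$ is at least $q(k)$ for all such $M,A,\mathcal E'$.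 *)

(* Defs.v *)
From Stdlib Require Import Bool Reals List Lia Lra.
Import ListNotations.
Open Scope R_scope.


(** Processes are 0, ..., n-1; registers are 0, ..., nregs-1, each holding
    an (unbounded) natural number. *)

Inductive Action : Type :=
| ARead  (r : nat)
| AWrite (r : nat) (v : nat)
| ARet   (b : bool).

Definition dist (X : Type) := list (R * X).

Definition dist_ok (X : Type) (d : dist X) : Prop :=
  Forall (fun x : R * X => 0 <= fst x) d /\ fold_right Rplus 0 (map fst d) = 1.

(** An implementation of TAS (for a fixed number n of processes).
    [st] is the type of local states of a process inside its TAS() call.
    [start p] is the (random) local state of process [p] when it invokes TAS();
    [act s] is the operation a process in state [s] is poised to perform;
    [next s v] is the (random) new local state after performing that operation
    and receiving response [v] (the value read, or 0 for a write).
    All local coin flips between two consecutive shared-memory steps are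
    thus a single finitely supported random choice. *)
Record Impl : Type := {
  st       : Type;
  nregs    : nat;
  init_mem : nat -> nat;
  start    : nat -> dist st;
  act      : st -> Action;
  next     : st -> nat -> dist st
}.

Definition valid_impl (I : Impl) : Prop :=
  (forall p, dist_ok (st I) (start I p)) /\
  (forall s v, dist_ok (st I) (next I s v)) /\
  (forall s, match act I s with
             | ARead r => (r < nregs I)%nat
             | AWrite r _ => (r < nregs I)%nat
             | ARet _ => True
             end).

Inductive Status (S : Type) : Type :=
| Idle
| Running (s : S)
| Done (b : bool).
Arguments Idle {S}.
Arguments Done {S}.
Arguments Running {S}.

Record Config (S : Type) : Type := {
  mem   : nat -> nat;
  stat  : nat -> Status S;
  steps : nat -> nat
}.
Arguments mem {S}.
Arguments stat {S}.
Arguments steps {S}.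
Arguments Build_Config {S}.

Definition upd {X : Type} (f : nat -> X) (x : nat) (v : X) : nat -> X :=
  fun y => if Nat.eqb y x then v else f y.

Definition is_idle (S : Type) (s : Status S) : bool :=
  match s with Idle => true | _ => false end.
Arguments is_idle {S}.

Definition mk_status (I : Impl) (s : st I) : Status (st I) :=
  match act I s with ARet b => Done b | _ => Running s end.

Definition ninvoked (S : Type) (n : nat) (c : Config S) : nat :=
  length (filter (fun p => negb (is_idle (stat c p))) (seq 0 n)).

Definition init_config (I : Impl) : Config (st I) :=
  {| mem := init_mem I; stat := fun _ => Idle; steps := fun _ => 0%nat |}.

(** One step of the system.  The adversary's choice is a pair [(p, inv)]:
    process [p] is scheduled; if [p] has not yet invoked TAS(), it invokes it
    iff [inv] is true and fewer than [k] processes have invoked TAS() so far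
    ([k] is the max-contention); otherwise the step of an idle or finished
    process is a step of the surrounding algorithm, which does not touch the
    TAS object. *)
Definition step (I : Impl) (n k : nat) (c : Config (st I)) (ch : nat * bool)
  : dist (Config (st I)) :=
  let (p, inv) := ch in
  if Nat.ltb p n then
    match stat c p with
    | Idle =>
        if inv && Nat.ltb (ninvoked (st I) n c) k then
          map (fun ws => (fst ws,
                 {| mem := mem c; stat := upd (stat c) p (mk_status I (snd ws));
                    steps := steps c |})) (start I p)
        else [(1, c)]
    | Running s =>
        match act I s with
        | ARead r =>
            map (fun ws => (fst ws,
                   {| mem := mem c; stat := upd (stat c) p (mk_status I (snd ws));
                      steps := upd (steps c) p (S (steps c p)) |}))
                (next I s (mem c r))
        | AWrite r v =>
            map (fun ws => (fst ws,
                   {| mem := upd (mem c) r v;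
                      stat := upd (stat c) p (mk_status I (snd ws));
                      steps := upd (steps c) p (S (steps c p)) |}))
                (next I s 0%nat)
        | ARet b =>
            [(1, {| mem := mem c; stat := upd (stat c) p (Done b);
                    steps := steps c |})]
        end
    | Done _ => [(1, c)]
    end
  else [(1, c)].

(** A strong adaptive adversary: sees the whole history (list of all
    configurations so far, most recent first; local states reveal all coin-flip
    outcomes) and chooses the next step. *)
Definition Adversary (I : Impl) : Type := list (Config (st I)) -> nat * bool.

Fixpoint expect (I : Impl) (n k : nat) (A : Adversary I) (t : nat)
  (f : list (Config (st I)) -> R) (h : list (Config (st I))) : R :=
  match t with
  | O => f h
  | S t' =>
      match h with
      | [] => f h
      | c :: _ =>
          fold_right Rplus 0
            (map (fun wc => fst wc * expect I n k A t' f (snd wc :: h))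
                 (step I n k c (A h)))
      end
  end.

Definition maxsteps (S : Type) (n : nat) (c : Config S) : nat :=
  fold_right Nat.max 0%nat (map (steps c) (seq 0 n)).

Definition cur_maxsteps (I : Impl) (n : nat) (h : list (Config (st I))) : nat :=
  maxsteps (st I) n (hd (init_config I) h).

Definition exp_maxsteps (I : Impl) (n k : nat) (A : Adversary I) (t : nat) : R :=
  expect I n k A t (fun h => INR (cur_maxsteps I n h)) [init_config I].

Definition prob_maxsteps_le (I : Impl) (n k : nat) (A : Adversary I) (t : nat)
  (B : R) : R :=
  expect I n k A t (fun h => if Rle_dec (INR (cur_maxsteps I n h)) B then 1 else 0)
    [init_config I].

Inductive reachable (I : Impl) (n k : nat) : list (Config (st I)) -> Prop :=
| reach0 : reachable I n k [init_config I]
| reachS : forall c h ch w c',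
    reachable I n k (c :: h) -> In (w, c') (step I n k c ch) -> 0 < w ->
    reachable I n k (c' :: c :: h).

Definition is_done (S : Type) (s : Status S) : bool :=
  match s with Done _ => true | _ => false end.
Arguments is_done {S}.

(** Linearizability of a history w.r.t. the sequential specification of a
    one-shot TAS object: there is a sequential order [ord] of all completed
    operations and some pending ones, respecting real-time order (if the
    operation of [a] responded before that of [b] was invoked, [a] comes
    first), in which the first operation returns 0 (false) and all others
    return 1 (true). Operations are identified with their process. *)
Definition linearizable (S : Type) (n : nat) (h : list (Config S)) : Prop :=
  forall c0 : Config S, hd_error h = Some c0 ->
  exists ord : list nat,
    NoDup ord /\
    (forall p, (p < n)%nat -> is_done (stat c0 p) = true -> In p ord) /\
    (forall p, In p ord -> (p < n)%nat /\ is_idle (stat c0 p) = false) /\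
    (forall a b, In a ord -> In b ord ->
       (exists c, In c h /\ is_done (stat c a) = true /\ is_idle (stat c b) = true) ->
       exists l1 l2 l3, ord = l1 ++ a :: l2 ++ b :: l3) /\
    (forall p b, In p ord -> stat c0 p = Done b ->
       (b = false <-> hd_error ord = Some p)).

Definition linearizable_impl (I : Impl) (n : nat) : Prop :=
  forall h, reachable I n n h -> linearizable (st I) n h.

(* Main.v *)
(** The implementation is a variant of RatRace.  A process draws a uniformly random path of [L]
    bits ([2 ^ L] is between [n] and [2 n]) and walks down it in a binary tree of splitters: a
    splitter stops at most one process, and lets a process pass only if another process reached the
    same node.  A process that stops climbs back to the root, fighting a two-process randomized duel
    at every node; one that passes the deepest level climbs from its own leaf of a second tournament
    tree instead.  That costs [O(L)], no more than its descent up to a constant, so a linear number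
    of registers suffices.  A loser closes a door before it returns, and processes that find the door
    closed lose at once; hence whoever is still in the game was invoked before any loser returned.

    The complexity bound comes from a single supermartingale, valid for every schedule, that
    dominates the sum over the processes of [1.01 ^ steps].  A descending process contributes
    [(3/2) ^ l] for each other invoked process, [l] being the length of their common path prefix,
    because it only gets one level below such a prefix; the mean of this term is bounded since
    [3/2 < 2].  A climbing process contributes [1.01 ^ steps * 1.2 ^ height] times a finite potential
    of its current duel, and [1.01 ^ 4 * 1.2 ^ 2 < 3/2] links the two phases.  Each new process
    adds a mean of [O(k)], so the exponential moment of the maximum is [O(k ^ 2)], which gives both
    the bound on the expectation and, by Markov's inequality, the tail bound. *)

From Stdlib Require Import Reals List Lia Lra Bool Arith Classical FunctionalExtensionality.
Require Import Defs.
Import ListNotations.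
Open Scope R_scope.

(** * Two-process duels *)

(** A two-process protocol in the style of Tromp and Vitányi. [ReadMe] shows me in its register and
    is about to read the opponent; [MeToChoose] still shows me and is about to write choose. A
    player that reads its own claim in the other register retreats to choose, where coins break the
    tie. *)
Inductive duel : Type :=
| Start | ReadMe | ReadHe | ReadChoose
| MeToChoose | HeToChoose | ChooseToMe | ChooseToHe
| Won | Lost.

(** Register values: 0 = untouched, 1 = "me", 2 = "he", 3 = "choose". *)
Definition duel_reg (a : duel) : nat :=
  match a with
  | Start => 0
  | ReadMe | MeToChoose | Won => 1
  | ReadHe | HeToChoose | Lost => 2
  | ReadChoose | ChooseToMe | ChooseToHe => 3
  end.

Definition duel_write (a : duel) : option nat :=
  match a with
  | Start | ChooseToMe => Some 1%nat
  | ChooseToHe => Some 2%nat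
  | MeToChoose | HeToChoose => Some 3%nat
  | _ => None
  end.

(** The two successor states are equally likely; [v] is the content of the opponent's register. *)
Definition duel_next (a : duel) (v : nat) : duel * duel :=
  match a with
  | Start | ChooseToMe => (ReadMe, ReadMe)
  | ChooseToHe => (ReadHe, ReadHe)
  | MeToChoose | HeToChoose => (ReadChoose, ReadChoose)
  | ReadMe => if Nat.eqb v 1 then (MeToChoose, MeToChoose) else (Won, Won)
  | ReadHe => if Nat.eqb v 2 then (HeToChoose, HeToChoose) else (Lost, Lost)
  | ReadChoose =>
      if Nat.eqb v 1 then (ChooseToHe, ChooseToHe)
      else if Nat.eqb v 2 then (ChooseToMe, ChooseToMe)
      else (ChooseToMe, ChooseToHe)
  | Won => (Won, Won)
  | Lost => (Lost, Lost)
  end.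

Definition undecided (a : duel) : bool :=
  match a with Won | Lost => false | _ => true end.

(** A supermartingale of the duel for every schedule, in hundredths: [duel_pot a b] bounds the
    expectation of [1.01 ^ s], where [s] is the number of steps a process in state [a] still takes
    against an opponent in state [b].  It is the least fixed point of the two inequalities of
    [duel_pot_step], rounded up; 0 marks the pairs that are not reachable from [(Start, Start)]. *)
Definition duel_pot (a b : duel) : nat :=
  let row (l : list nat) :=
    nth (match b with
         | Start => 0 | ReadMe => 1 | ReadHe => 2 | ReadChoose => 3
         | MeToChoose => 4 | HeToChoose => 5 | ChooseToMe => 6 | ChooseToHe => 7
         | Won => 8 | Lost => 9 end) l 0%nat in
  match a with
  | Start      => row [119; 119;   0;   0;   0;   0;   0;   0; 111;   0]
  | ReadMe     => row [117; 117; 101; 101; 117; 101; 117; 101; 109; 101]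
  | ReadHe     => row [  0; 101; 117; 101; 101; 117; 101; 117; 101; 109]
  | ReadChoose => row [  0; 105; 105; 113; 113; 113; 113; 113; 105; 105]
  | MeToChoose => row [  0; 115; 107; 115; 115;   0;   0; 115; 107; 107]
  | HeToChoose => row [  0; 107; 115; 115;   0; 115; 115;   0; 107; 107]
  | ChooseToMe => row [  0; 119; 103; 111;   0; 111; 119; 103; 111; 103]
  | ChooseToHe => row [  0; 103; 119; 111; 111;   0; 103; 119; 103; 111]
  | Won        => row [100; 100; 100; 100; 100; 100; 100; 100;   0; 100]
  | Lost       => row [  0; 100; 100; 100; 100; 100; 100; 100; 100;   0]
  end%nat.

(** The table doubles as the safety invariant: its support is closed under the moves of either
    player and contains neither two winners nor two losers. *)
Definition compat (a b : duel) : Prop := duel_pot a b <> 0%nat.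

Lemma compat_sym (a b : duel) : compat a b -> compat b a.
Proof. destruct a, b; unfold compat; simpl; lia. Qed.

Lemma compat_next (a b : duel) :
  compat a b -> undecided a = true ->
  compat (fst (duel_next a (duel_reg b))) b /\ compat (snd (duel_next a (duel_reg b))) b.
Proof. destruct a, b; unfold compat; simpl; lia. Qed.

Lemma compat_Won (b : duel) : compat Won b -> b <> Won.
Proof. destruct b; unfold compat; simpl; congruence. Qed.

(** A loser's opponent has joined the duel and is active or has won; this always leaves somebody in
    the game. *)
Lemma compat_Lost (b : duel) : compat Lost b -> b <> Lost /\ b <> Start.
Proof. destruct b; unfold compat; simpl; split; congruence. Qed.

Definition duel_potR (a b : duel) : R := INR (duel_pot a b) / 100.

(** A finite check. The mover pays the factor 1.01 for its step, the waiting player only sees its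
    opponent change; the factor 2 clears the two coin weights 1/2. *)
Lemma duel_pot_step (a b : duel) :
  compat a b -> undecided a = true ->
  let (a1, a2) := duel_next a (duel_reg b) in
  1.01 * (duel_potR a1 b + duel_potR a2 b) <= 2 * duel_potR a b /\
  duel_potR b a1 + duel_potR b a2 <= 2 * duel_potR b a.
Proof.
  destruct a, b; unfold compat, duel_potR; simpl duel_pot; intros Hc Hu;
    try (exfalso; apply Hc; reflexivity); try discriminate Hu;
    simpl; lra.
Qed.

(** The lower bound makes the potential dominate the steps already taken. The upper bound 1.2 is the
    credit reserved per unit of height, enough to start any new duel. *)
Lemma duel_potR_bounds (a b : duel) :
  compat a b -> 1 <= duel_potR a b <= 1.2.
Proof.
  destruct a, b; unfold compat, duel_potR; simpl duel_pot; intros Hc;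
    try (exfalso; apply Hc; reflexivity); simpl; lra.
Qed.

Lemma duel_next_not_Start (a : duel) (v : nat) :
  fst (duel_next a v) <> Start /\ snd (duel_next a v) <> Start.
Proof. destruct a; simpl; repeat (destruct (Nat.eqb _ _)); simpl; split; discriminate. Qed.

Lemma duel_write_next (a : duel) (v w : nat) :
  duel_write a = Some w ->
  duel_next a v = duel_next a 0 /\
  duel_reg (fst (duel_next a v)) = w /\ duel_reg (snd (duel_next a v)) = w.
Proof. destruct a; simpl; intros [= <-]; auto. Qed.

Lemma duel_read_next (a : duel) (v : nat) :
  duel_write a = None ->
  duel_reg (fst (duel_next a v)) = duel_reg a /\ duel_reg (snd (duel_next a v)) = duel_reg a.
Proof.
  destruct a; simpl; try discriminate; intros _;
    repeat (destruct (Nat.eqb _ _)); auto.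
Qed.

(** * Node numbering, tournament and registers *)

(** Heap numbering with root 1; the leading binary digit records the depth, so numbers of different
    depths never coincide. *)
Definition node (P : list bool) : nat :=
  fold_left (fun v b => 2 * v + Nat.b2n b)%nat P 1%nat.

Lemma node_snoc (P : list bool) (b : bool) :
  node (P ++ [b]) = (2 * node P + Nat.b2n b)%nat.
Proof. unfold node. rewrite fold_left_app. reflexivity. Qed.

Lemma node_bounds (P : list bool) :
  (2 ^ length P <= node P < 2 ^ S (length P))%nat.
Proof.
  induction P as [|b P IH] using rev_ind; [cbv; lia|].
  rewrite node_snoc, length_app, Nat.add_comm. simpl in *. destruct b; simpl; lia.
Qed.

Lemma log2_node (P : list bool) : Nat.log2 (node P) = length P.
Proof. apply Nat.log2_unique; [lia | apply node_bounds]. Qed.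

Lemma node_inj (P Q : list bool) : node P = node Q -> P = Q.
Proof.
  revert Q. induction P as [|b P IH] using rev_ind; intros Q H;
    destruct Q as [|b' Q _] using rev_ind; auto; rewrite ?node_snoc in H.
  - pose proof (node_bounds Q). pose proof (Nat.pow_nonzero 2 (length Q)). cbn in H. lia.
  - pose proof (node_bounds P). pose proof (Nat.pow_nonzero 2 (length P)). cbn in H. lia.
  - assert (Hb : b = b') by (destruct b, b'; simpl in H; auto; lia).
    subst b'. f_equal. apply IH. lia.
Qed.

(** The duels: [Outer v] between the process that stopped at node [v] of the splitter tree and the
    winner of [Inner v]; [Inner v] between the winners of the two subtrees below [v]; [Backup u] is
    an ordinary tournament over process identifiers.  [Backup 0] is the final. *)
Inductive obj : Type := Backup (u : nat) | Outer (v : nat) | Inner (v : nat).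

Definition obj_eq_dec (o o' : obj) : {o = o'} + {o <> o'}.
Proof. decide equality; apply Nat.eq_dec. Defined.

(** The winner of [Outer 1] takes slot [false] of the final. The backup tree is a heap with root 1,
    so halving sends the winner of [Backup 1] to slot [true] of the final. *)
Definition up (o : obj) : obj * bool :=
  match o with
  | Backup u => (Backup (u / 2), Nat.odd u)
  | Outer v => if Nat.leb v 1 then (Backup 0, false) else (Inner (v / 2), Nat.odd v)
  | Inner v => (Outer v, true)
  end.

Inductive reg : Type := RDoor | RX (v : nat) | RY (v : nat) | RDuel (o : obj) (s : bool).

Definition reg_eq_dec (r r' : reg) : {r = r'} + {r <> r'}.
Proof. decide equality; try apply Nat.eq_dec; try apply obj_eq_dec; apply bool_dec. Defined.

(** One block of eight addresses per number [v]; the shift by one block keeps the door at 0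
    apart. *)
Definition addr (r : reg) : nat :=
  match r with
  | RDoor => 0
  | RX v => 8 * (v + 1)
  | RY v => 8 * (v + 1) + 1
  | RDuel (Outer v) s => 8 * (v + 1) + 2 + Nat.b2n s
  | RDuel (Inner v) s => 8 * (v + 1) + 4 + Nat.b2n s
  | RDuel (Backup v) s => 8 * (v + 1) + 6 + Nat.b2n s
  end.

Lemma addr_inj (r r' : reg) : addr r = addr r' -> r = r'.
Proof.
  destruct r as [|v|v|[v|v|v] []], r' as [|w|w|[w|w|w] []]; unfold addr, Nat.b2n; intros H;
    solve [ reflexivity | exfalso; lia | assert (v = w) by lia; subst; reflexivity ].
Qed.

#[local] Arguments Nat.div : simpl never.
#[local] Arguments Nat.pow : simpl never.
#[local] Arguments Nat.mul : simpl never.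

(** * The algorithm *)

Inductive stage : Type := WriteX | ReadY | WriteY | ReadX.

(** [Split p P d s]: process [p], whose random path is [P], executes the splitter of the node at
    depth [d] of [P].  Registers of splitters hold [S p] for process [p]. *)
Inductive pstate : Type :=
| Door (p : nat) (P : list bool)
| Split (p : nat) (P : list bool) (d : nat) (s : stage)
| Climb (o : obj) (s : bool) (a : duel)
| CloseDoor
| Exit (b : bool).

Inductive paction : Type := PRead (r : reg) | PWrite (r : reg) (v : nat) | PRet (b : bool).

Definition pact (s : pstate) : paction :=
  match s with
  | Door _ _ => PRead RDoor
  | Split p P d WriteX => PWrite (RX (node (firstn d P))) (S p)
  | Split p P d ReadY => PRead (RY (node (firstn d P)))
  | Split p P d WriteY => PWrite (RY (node (firstn d P))) (S p)
  | Split p P d ReadX => PRead (RX (node (firstn d P)))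
  | Climb o s a =>
      match duel_write a with
      | Some v => PWrite (RDuel o s) v
      | None => PRead (RDuel o (negb s))
      end
  | CloseDoor => PWrite RDoor 1
  | Exit b => PRet b
  end.

Definition start_climb (m : obj * bool) : pstate := Climb (fst m) (snd m) Start.

Definition after_duel (o : obj) (s : bool) (a : duel) : pstate :=
  match a with
  | Won => if obj_eq_dec o (Backup 0) then Exit false else start_climb (up o)
  | Lost => CloseDoor
  | _ => Climb o s a
  end.

Section Algorithm.
Variable L : nat.

(** Past depth [L] the process plays its first duel at the parent of its own backup leaf
    [2 ^ L + p]. *)
Definition descend (p : nat) (P : list bool) (d : nat) : pstate :=
  if Nat.ltb d L then Split p P (S d) WriteX else start_climb (up (Backup (2 ^ L + p))).

Definition pnext (s : pstate) (v : nat) : dist pstate :=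
  match s with
  | Door p P => [(1, if Nat.eqb v 0 then Split p P 0 WriteX else Exit true)]
  | Split p P d WriteX => [(1, Split p P d ReadY)]
  | Split p P d ReadY => [(1, if Nat.eqb v 0 then Split p P d WriteY else descend p P d)]
  | Split p P d WriteY => [(1, Split p P d ReadX)]
  | Split p P d ReadX =>
      [(1, if Nat.eqb v (S p) then Climb (Outer (node (firstn d P))) false Start
           else descend p P d)]
  | Climb o s a =>
      let (a1, a2) := duel_next a v in [(1/2, after_duel o s a1); (1/2, after_duel o s a2)]
  | CloseDoor => [(1, Exit true)]
  | Exit b => [(1, Exit b)]
  end.

Fixpoint random_path (l : nat) : dist (list bool) :=
  match l with
  | O => [(1, [])]
  | S l => map (fun x => (fst x / 2, false :: snd x)) (random_path l) ++
           map (fun x => (fst x / 2, true :: snd x)) (random_path l)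
  end.

Definition register_count : nat := 8 * (2 ^ S L + 1).

(** States outside the register range are unreachable; exiting there makes the implementation valid. *)
Definition compile (a : paction) : Action :=
  match a with
  | PRead r => if Nat.ltb (addr r) register_count then ARead (addr r) else ARet true
  | PWrite r v => if Nat.ltb (addr r) register_count then AWrite (addr r) v else ARet true
  | PRet b => ARet b
  end.

Definition ratrace : Impl :=
  {| st := pstate;
     nregs := register_count;
     init_mem := fun _ => 0%nat;
     start := fun p => map (fun x => (fst x, Door p (snd x))) (random_path L);
     act := fun s => compile (pact s);
     next := pnext |}.

Lemma random_path_ok (l : nat) : dist_ok (list bool) (random_path l).
Proof.
  induction l as [|l [IH1 IH2]]; [split; simpl; [repeat constructor; simpl; lra | lra]|].
  split; simpl.
  - apply Forall_app; split; apply Forall_map; eapply Forall_impl; try exact IH1;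
      simpl; intros; lra.
  - rewrite map_app, !map_map. simpl.
    assert (H : forall d : dist (list bool),
      fold_right Rplus 0 (map (fun x => fst x / 2) d) = fold_right Rplus 0 (map fst d) / 2).
    { induction d as [|x d IHd]; simpl; lra. }
    rewrite fold_right_app, H, IH2.
    assert (H' : forall a (d : dist (list bool)),
      fold_right Rplus a (map (fun x => fst x / 2) d) = a + fold_right Rplus 0 (map fst d) / 2).
    { induction d as [|x d IHd]; simpl; lra. }
    rewrite H', IH2. lra.
Qed.

Lemma random_path_length (l : nat) (x : R * list bool) :
  In x (random_path l) -> length (snd x) = l.
Proof.
  revert x. induction l as [|l IH]; simpl; intros x Hx.
  - destruct Hx as [<-|[]]. reflexivity.
  - apply in_app_or in Hx. rewrite !in_map_iff in Hx.
    destruct Hx as [(y & <- & Hy)|(y & <- & Hy)]; simpl; f_equal; auto.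
Qed.

Lemma ratrace_valid : valid_impl ratrace.
Proof.
  split; [|split].
  - intros p. destruct (random_path_ok L) as [H1 H2]. split; simpl.
    + apply Forall_map. exact H1.
    + rewrite map_map. exact H2.
  - intros s v. destruct s as [p P|p P d []|o s a| |b]; simpl;
      try (split; [repeat constructor; simpl; lra | simpl; lra]).
    destruct (duel_next a v) as [a1 a2].
    split; [repeat constructor; simpl; lra | simpl; lra].
  - intros s. simpl. unfold compile. destruct (pact s) as [r|r v|b]; auto;
      destruct (Nat.ltb_spec (addr r) register_count); auto.
Qed.

(** * Ranges of nodes and registers *)

Definition obj_ok (o : obj) : Prop :=
  match o with
  | Backup u => (u < 2 ^ L)%nat
  | Outer v | Inner v => (1 <= v < 2 ^ S L)%nat
  end.

Definition reg_ok (r : reg) : Prop :=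
  match r with
  | RDoor => True
  | RX v | RY v => (v < 2 ^ S L)%nat
  | RDuel o _ => obj_ok o
  end.

Lemma reg_ok_addr (r : reg) : reg_ok r -> (addr r < register_count)%nat.
Proof.
  unfold register_count. assert (H : (2 ^ S L = 2 * 2 ^ L)%nat) by reflexivity.
  destruct r as [|v|v|[v|v|v] []]; unfold reg_ok, obj_ok, addr, Nat.b2n; lia.
Qed.

Definition state_ok (s : pstate) : Prop :=
  match s with
  | Split _ P d _ => (d <= L)%nat
  | Climb o _ _ => obj_ok o
  | _ => True
  end.

Definition action_ok (a : paction) : Prop :=
  match a with PRead r | PWrite r _ => reg_ok r | PRet _ => True end.

Lemma node_firstn_lt (P : list bool) (d : nat) :
  (d <= L)%nat -> (1 <= node (firstn d P) < 2 ^ S L)%nat.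
Proof.
  intros Hd. pose proof (node_bounds (firstn d P)).
  assert (length (firstn d P) <= d)%nat by apply firstn_le_length.
  assert (2 ^ S (length (firstn d P)) <= 2 ^ S L)%nat by (apply Nat.pow_le_mono_r; lia).
  pose proof (Nat.pow_nonzero 2 (length (firstn d P))). lia.
Qed.

Lemma state_ok_action (s : pstate) : state_ok s -> action_ok (pact s).
Proof.
  destruct s as [p P|p P d []|o s a| |b]; simpl; auto;
    try (intros Hd; apply (node_firstn_lt P) in Hd; simpl in Hd; lia).
  destruct (duel_write a); simpl; auto.
Qed.

Definition settle (s : pstate) : Status pstate :=
  match s with Exit b => Done b | _ => Running s end.

Lemma compile_ok (a : paction) :
  action_ok a ->
  compile a = match a with
              | PRead r => ARead (addr r) | PWrite r v => AWrite (addr r) v | PRet b => ARet b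
              end.
Proof.
  destruct a as [r|r v|b]; simpl; auto; intros H; apply reg_ok_addr in H;
    apply Nat.ltb_lt in H; rewrite H; reflexivity.
Qed.

(** In range, the escape branches of [compile] are never taken, so only [Exit] ends a call. *)
Lemma mk_status_settle (s : pstate) : state_ok s -> mk_status ratrace s = settle s.
Proof.
  intros H. apply state_ok_action in H. unfold mk_status. simpl. rewrite compile_ok by exact H.
  destruct s as [p P|p P d []|o s a| |b]; simpl; auto.
  destruct (duel_write a); auto.
Qed.

Lemma up_ok (o : obj) : obj_ok o -> o <> Backup 0 -> obj_ok (fst (up o)).
Proof.
  destruct o as [u|v|v]; simpl; intros H Hr; auto.
  - assert (u / 2 <= u)%nat by (apply Nat.Div0.div_le_upper_bound; lia). lia.
  - destruct (Nat.leb_spec v 1); simpl.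
    + pose proof (Nat.pow_nonzero 2 L). lia.
    + assert (v / 2 <= v)%nat by (apply Nat.Div0.div_le_upper_bound; lia).
      assert (1 <= v / 2)%nat by (apply Nat.div_le_lower_bound; lia). lia.
Qed.

Lemma leaf_ok (p : nat) : (1 <= L)%nat -> (p < 2 ^ L)%nat -> obj_ok (fst (up (Backup (2 ^ L + p)))).
Proof.
  intros HL Hp. simpl. apply Nat.Div0.div_lt_upper_bound. lia.
Qed.

Lemma descend_ok (p : nat) (P : list bool) (d : nat) :
  (1 <= L)%nat -> (p < 2 ^ L)%nat -> state_ok (descend p P d).
Proof.
  intros HL Hp. unfold descend. destruct (Nat.ltb_spec d L).
  - simpl. lia.
  - exact (leaf_ok p HL Hp).
Qed.

End Algorithm.

(** * Invariants *)

(** History variables: the current or final state of the user of each slot of each duel ([Start] if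
    there was none so far), the nodes whose splitter has stopped a process, the random paths. *)
Record ghost : Type := {
  duel_of : obj -> bool -> duel;
  stopped : nat -> bool;
  path_of : nat -> list bool
}.

Definition upd_duel (D : obj -> bool -> duel) (o : obj) (s : bool) (a : duel) : obj -> bool -> duel :=
  fun o' s' => if obj_eq_dec o' o then if bool_dec s' s then a else D o' s' else D o' s'.

Lemma upd_duel_eq D o s a : upd_duel D o s a o s = a.
Proof. unfold upd_duel. destruct (obj_eq_dec o o), (bool_dec s s); congruence. Qed.

Lemma upd_duel_neq D o s a o' s' : (o', s') <> (o, s) -> upd_duel D o s a o' s' = D o' s'.
Proof. intros H. unfold upd_duel. destruct (obj_eq_dec o' o), (bool_dec s' s); congruence. Qed.

Lemma upd_eq (X : Type) (f : nat -> X) x v : upd f x v x = v.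
Proof. unfold upd. rewrite Nat.eqb_refl. reflexivity. Qed.

Lemma upd_neq (X : Type) (f : nat -> X) x v y : y <> x -> upd f x v y = f y.
Proof. intros H. unfold upd. apply Nat.eqb_neq in H. rewrite H. reflexivity. Qed.

Definition stage_index (s : stage) : nat :=
  match s with WriteX => 0 | ReadY => 1 | WriteY => 2 | ReadX => 3 end.

Section Invariants.
Variables n L : nat.

Notation status := (Status pstate).

Definition at_door (S : nat -> status) (p : nat) : Prop :=
  exists i P, S p = Running (Door i P).
Definition splitting (S : nat -> status) (p d : nat) (s : stage) : Prop :=
  exists i P, S p = Running (Split i P d s).
Definition climbing (S : nat -> status) (p : nat) (o : obj) (s : bool) : Prop :=
  exists a, S p = Running (Climb o s a).

(** A permanent condition, and false as long as [p] is splitting: it can justify the entry of [p] at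
    its backup leaf only once. *)
Definition entered (S : nat -> status) (p : nat) : Prop :=
  S p <> Idle /\ ~ at_door S p /\ forall d s, ~ splitting S p d s.

(** The bound on [t] counts one step at the door and four per splitter already passed. Climbing
    steps get no bound here; the potential pays for them. [Exit] is impossible because it settles to
    [Done] at once. *)
Definition local_at (g : ghost) (p : nat) (x : status) (t : nat) : Prop :=
  match x with
  | Idle => t = 0%nat
  | Done _ => (p < n)%nat /\ length (path_of g p) = L
  | Running s =>
      (p < n)%nat /\ length (path_of g p) = L /\
      match s with
      | Door i P => i = p /\ P = path_of g p /\ t = 0%nat
      | Split i P d s =>
          i = p /\ P = path_of g p /\ (d <= L)%nat /\ (t <= 4 * d + 1 + stage_index s)%nat
      | Climb _ _ _ => True
      | CloseDoor => exists o s, duel_of g o s = Lost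
      | Exit _ => False
      end
  end.

Definition local_inv (S : nat -> status) (T : nat -> nat) (g : ghost) : Prop :=
  forall p, local_at g p (S p) (T p).

(** Links a returned [true] to a closed door and a closed door to a lost duel, hence to a surviving
    candidate. *)
Definition door_inv (M : reg -> nat) (S : nat -> status) (g : ghost) : Prop :=
  (M RDoor <> 0%nat -> exists o s, duel_of g o s = Lost) /\
  (forall p, S p = Done true -> M RDoor <> 0%nat).

Definition prefix_node (g : ghost) (p d : nat) : nat := node (firstn d (path_of g p)).

Definition collided (S : nat -> status) (g : ghost) (p d : nat) : Prop :=
  exists q, q <> p /\ S q <> Idle /\ firstn d (path_of g q) = firstn d (path_of g p).

(** At most one process stops per node: afterwards Y is set, so nobody newly reaches [WriteY] there
    ([stopped_Y]), and those already beyond [ReadY] no longer own X ([stopped_X]). The remaining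
    fields attribute every failure to another visitor: registers hold names of processes whose paths
    run through the node, and a process about to read Y has not written that Y itself. *)
Record split_inv (M : reg -> nat) (S : nat -> status) (g : ghost) : Prop := {
  stopped_Y : forall v, stopped g v = true -> M (RY v) <> 0%nat;
  late_Y : forall p d, splitting S p d ReadX -> M (RY (prefix_node g p d)) <> 0%nat;
  stopped_X : forall v p d s,
    stopped g v = true -> splitting S p d s -> (s = WriteY \/ s = ReadX) ->
    prefix_node g p d = v -> M (RX v) <> Datatypes.S p;
  late_X : forall p d s,
    splitting S p d s -> s <> WriteX -> M (RX (prefix_node g p d)) <> 0%nat;
  split_Y : forall p d s v,
    splitting S p d s -> M (RY v) = Datatypes.S p ->
    (Nat.log2 v < d)%nat \/ (Nat.log2 v = d /\ s = ReadX);
  door_Y : forall p v, at_door S p -> M (RY v) <> Datatypes.S p;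
  visited : forall v q,
    M (RX v) = Datatypes.S q \/ M (RY v) = Datatypes.S q ->
    S q <> Idle /\ exists d, (d <= L)%nat /\ v = prefix_node g q d;
  split_collided : forall p d s, splitting S p (Datatypes.S d) s -> collided S g p d
}.

Definition won (g : ghost) (o : obj) : Prop := exists s, duel_of g o s = Won.

(** A climber that has not yet written still has [duel_of] equal to [Start]; the second disjunct
    catches it. *)
Definition touched (S : nat -> status) (g : ghost) (o : obj) (s : bool) : Prop :=
  duel_of g o s <> Start \/ exists p, climbing S p o s.

(** The event that allows somebody to enter slot [(o, s)]; it happens at most once. *)
Definition justified (S : nat -> status) (g : ghost) (o : obj) (s : bool) : Prop :=
  match o, s with
  | Outer v, false => stopped g v = true
  | Outer v, true => won g (Inner v)
  | Inner v, s => won g (Outer (2 * v + Nat.b2n s))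
  | Backup u, s =>
      let w := (2 * u + Nat.b2n s)%nat in
      if Nat.eqb w 0 then won g (Outer 1)
      else if Nat.ltb w (2 ^ L) then won g (Backup w) else entered S (w - 2 ^ L)
  end.

(** Each slot has at most one user: [touched_justified] turns a second entry into a second
    occurrence of the one-time event [justified]. [won_up] follows a winner to the place where it
    continues. *)
Record duel_inv (M : reg -> nat) (S : nat -> status) (g : ghost) : Prop := {
  duel_mem : forall o s, M (RDuel o s) = duel_reg (duel_of g o s);
  duel_compat : forall o, compat (duel_of g o false) (duel_of g o true);
  climb_ok : forall p o s a, S p = Running (Climb o s a) ->
    obj_ok L o /\ undecided a = true /\ duel_of g o s = a;
  duel_owner : forall o s,
    undecided (duel_of g o s) = true -> duel_of g o s <> Start -> exists p, climbing S p o s;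
  won_up : forall o s, duel_of g o s = Won ->
    (o = Backup 0 /\ exists p, S p = Done false) \/
    (o <> Backup 0 /\ touched S g (fst (up o)) (snd (up o)));
  climb_unique : forall p q o s, climbing S p o s -> climbing S q o s -> p = q;
  touched_justified : forall o s, touched S g o s -> justified S g o s;
  winner_won : forall p, S p = Done false -> won g (Backup 0);
  winner_unique : forall p q, S p = Done false -> S q = Done false -> p = q
}.

Definition regs (c : Config pstate) : reg -> nat := fun r => mem c (addr r).

Record inv (c : Config pstate) (g : ghost) : Prop := {
  inv_local : local_inv (stat c) (steps c) g;
  inv_door : door_inv (regs c) (stat c) g;
  inv_split : split_inv (regs c) (stat c) g;
  inv_duel : duel_inv (regs c) (stat c) g
}.

Definition upd_reg (M : reg -> nat) (r : reg) (v : nat) : reg -> nat :=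
  fun r' => if reg_eq_dec r' r then v else M r'.

Lemma regs_upd (m : nat -> nat) (r : reg) (v : nat) :
  (fun r' => upd m (addr r) v (addr r')) = upd_reg (fun r' => m (addr r')) r v.
Proof.
  extensionality r'. unfold upd_reg. destruct (reg_eq_dec r' r) as [->|H].
  - apply upd_eq.
  - apply upd_neq. intros H'. apply H, addr_inj, H'.
Qed.

Lemma compat_slots M S g o s :
  duel_inv M S g -> compat (duel_of g o s) (duel_of g o (negb s)).
Proof.
  intros H. destruct s; simpl; [apply compat_sym|]; apply (duel_compat _ _ _ H).
Qed.

Lemma odd_div2 (v : nat) : (2 * (v / 2) + Nat.b2n (Nat.odd v))%nat = v.
Proof. rewrite <- Nat.div2_div. symmetry. apply Nat.div2_odd. Qed.

Lemma justified_up S g o :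
  obj_ok L o -> o <> Backup 0 -> (justified S g (fst (up o)) (snd (up o)) <-> won g o).
Proof.
  destruct o as [u|v|v]; simpl; intros Hok Hr.
  - rewrite odd_div2. destruct (Nat.eqb_spec u 0); [congruence|].
    destruct (Nat.ltb_spec u (2 ^ L)); [reflexivity|lia].
  - destruct (Nat.leb_spec v 1); simpl.
    + replace v with 1%nat by lia. reflexivity.
    + rewrite odd_div2. reflexivity.
  - reflexivity.
Qed.

Lemma justified_leaf S g p :
  justified S g (fst (up (Backup (2 ^ L + p)))) (snd (up (Backup (2 ^ L + p)))) <-> entered S p.
Proof.
  simpl. rewrite odd_div2. pose proof (Nat.pow_nonzero 2 L).
  destruct (Nat.eqb_spec (2 ^ L + p) 0); [lia|].
  destruct (Nat.ltb_spec (2 ^ L + p) (2 ^ L)); [lia|].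
  replace (2 ^ L + p - 2 ^ L)%nat with p by lia. reflexivity.
Qed.

(** * Some candidate is always left *)

(** Those who have seen the door open and may still win or have won. A process at the door is left
    out, since it may yet find the door closed. *)
Definition candidate (S : nat -> status) (p : nat) : Prop :=
  match S p with
  | Running (Split _ _ _ _) | Running (Climb _ _ _) | Done false => True
  | _ => False
  end.

Lemma climbing_candidate S p o s : climbing S p o s -> candidate S p.
Proof. intros [a H]. unfold candidate. rewrite H. exact I. Qed.

(** The number of duels from [o] through the final, both included; each node of the splitter tree
    carries two of them. *)
Definition height (o : obj) : nat :=
  match o with
  | Backup u => if Nat.eqb u 0 then 1 else Nat.log2 u + 2
  | Outer v => 2 * Nat.log2 v + 2
  | Inner v => 2 * Nat.log2 v + 3
  end.

Lemma log2_half (v : nat) : (2 <= v)%nat -> Nat.log2 v = Datatypes.S (Nat.log2 (v / 2)).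
Proof.
  intros Hv. rewrite <- Nat.div2_div.
  pose proof (Nat.div2_odd v) as H. destruct (Nat.odd v); cbn [Nat.b2n] in H.
  - rewrite H at 1. apply Nat.log2_succ_double. lia.
  - rewrite H at 1. rewrite Nat.add_0_r. apply Nat.log2_double. lia.
Qed.

Lemma height_up (o : obj) : o <> Backup 0 -> (height (fst (up o)) < height o)%nat.
Proof.
  destruct o as [u|v|v]; simpl; intros Hr; try lia.
  - destruct (Nat.eqb_spec u 0); [congruence|].
    destruct (Nat.eqb_spec (u / 2) 0); [lia|].
    assert (2 <= u)%nat.
    { destruct (Nat.le_gt_cases 2 u); auto. rewrite Nat.div_small in *; lia. }
    rewrite (log2_half u) by auto. lia.
  - destruct (Nat.leb_spec v 1); simpl; [lia|]. rewrite (log2_half v) by lia. lia.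
Qed.

(** Induction on [height]. An undecided slot in use has an owner. A winner is [Done false] or has
    touched the slot above, which is lower in height. Next to a loser, the other slot is undecided
    or won. *)
Lemma touched_candidate M S g o s :
  duel_inv M S g -> touched S g o s -> exists p, candidate S p.
Proof.
  intros HI. remember (height o) as h eqn:Hh. revert o s Hh.
  induction h as [h IH] using lt_wf_ind. intros o s -> Ht.
  assert (Hrun : forall s', undecided (duel_of g o s') = true -> touched S g o s' ->
                 exists p, candidate S p).
  { intros s' Hu [Hn|[p Hp]].
    - destruct (duel_owner _ _ _ HI o s' Hu Hn) as [p Hp]. eauto using climbing_candidate.
    - eauto using climbing_candidate. }
  assert (Hwon : forall s', duel_of g o s' = Won -> exists p, candidate S p).
  { intros s' Hw. destruct (won_up _ _ _ HI o s' Hw) as [[-> [p Hp]]|[Hr Ht']].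
    - exists p. unfold candidate. rewrite Hp. exact I.
    - eapply (IH (height (fst (up o)))); [apply height_up; exact Hr | reflexivity | exact Ht']. }
  destruct (duel_of g o s) eqn:E;
    try (apply (Hrun s); [rewrite E; reflexivity | exact Ht]); [eauto|].
  pose proof (compat_slots _ _ _ o s HI) as Hc. rewrite E in Hc.
  apply compat_Lost in Hc. destruct Hc as [Hl Hst].
  destruct (duel_of g o (negb s)) eqn:E'; try congruence;
    try (apply (Hrun (negb s)); [rewrite E'; reflexivity | left; congruence]).
  eapply Hwon, E'.
Qed.

Lemma lost_candidate M S g o s :
  duel_inv M S g -> duel_of g o s = Lost -> exists p, candidate S p.
Proof. intros HI H. apply (touched_candidate M S g o s HI). left. congruence. Qed.

Lemma inv_candidate c g p :
  inv c g -> stat c p = Done true -> exists q, candidate (stat c) q.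
Proof.
  intros [_ [H1 H2] _ HI] Hp. destruct (H1 (H2 _ Hp)) as (o & s & Hl).
  eapply lost_candidate; eauto.
Qed.

End Invariants.

(** * Preservation of the invariants *)

Section Preservation.
Variables n L : nat.

Notation status := (Status pstate).

Lemma local_nonidle g p x t :
  local_at n L g p x t -> x <> Idle -> (p < n)%nat /\ length (path_of g p) = L.
Proof. destruct x as [|s|b]; simpl; intuition congruence. Qed.

Lemma local_step S T g g' p x t :
  local_inv n L S T g -> path_of g' = path_of g ->
  (forall o s, duel_of g o s = Lost -> duel_of g' o s = Lost) ->
  local_at n L g' p x t -> local_inv n L (upd S p x) (upd T p t) g'.
Proof.
  intros HI Hp HL Hx q. destruct (Nat.eq_dec q p) as [->|Hq].
  - rewrite !upd_eq. exact Hx.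
  - rewrite !upd_neq by auto. specialize (HI q). revert HI.
    unfold local_at. rewrite Hp. destruct (S q) as [|[]|]; auto.
    intros (H1 & H2 & o & s & H3). eauto 7.
Qed.

Lemma splitting_upd S p x q d s :
  splitting (upd S p x) q d s ->
  (q = p /\ exists i P, x = Running (Split i P d s)) \/ (q <> p /\ splitting S q d s).
Proof.
  intros (i & P & H). destruct (Nat.eq_dec q p) as [->|Hq].
  - rewrite upd_eq in H. left. eauto.
  - rewrite upd_neq in H by auto. right. split; auto. exists i, P. auto.
Qed.

Lemma at_door_upd S p x q :
  at_door (upd S p x) q ->
  (q = p /\ exists i P, x = Running (Door i P)) \/ (q <> p /\ at_door S q).
Proof.
  intros (i & P & H). destruct (Nat.eq_dec q p) as [->|Hq].
  - rewrite upd_eq in H. left. eauto.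
  - rewrite upd_neq in H by auto. right. split; auto. exists i, P. auto.
Qed.

Lemma climbing_upd S p x q o s :
  climbing (upd S p x) q o s ->
  (q = p /\ exists a, x = Running (Climb o s a)) \/ (q <> p /\ climbing S q o s).
Proof.
  intros (a & H). destruct (Nat.eq_dec q p) as [->|Hq].
  - rewrite upd_eq in H. left. eauto.
  - rewrite upd_neq in H by auto. right. split; auto. exists a. auto.
Qed.

Lemma nonidle_upd (S : nat -> status) p x q : x <> Idle -> S q <> Idle -> upd S p x q <> Idle.
Proof.
  intros Hx Hq. destruct (Nat.eq_dec q p) as [->|H]; [rewrite upd_eq | rewrite upd_neq]; auto.
Qed.

Lemma collided_upd (S : nat -> status) g g' p x q d :
  x <> Idle -> path_of g' = path_of g -> collided S g q d -> collided (upd S p x) g' q d.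
Proof.
  intros Hx Hp (r & H1 & H2 & H3). exists r. rewrite Hp. eauto using nonidle_upd.
Qed.

Ltac subst_new H :=
  injection H; clear H;
  repeat match goal with
  | |- _ = ?b -> _ => is_var b; let E := fresh in intros E; subst b
  | |- ?a = Datatypes.S _ -> _ => is_var a; let E := fresh in intros E; subst a
  | |- _ = _ -> _ => intros _
  end.

Ltac split_cases :=
  repeat match goal with
  | H : splitting (upd _ _ _) _ _ _ |- _ =>
      apply splitting_upd in H as [[-> (? & ? & H)]|[? H]];
      [ try discriminate H; try (subst_new H) |]
  | H : at_door (upd _ _ _) _ |- _ =>
      apply at_door_upd in H as [[-> (? & ? & H)]|[? H]];
      [ try discriminate H; try (subst_new H) |]
  end.

(** Covers every step that neither writes a splitter register nor continues inside the splitter tree. *)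
Lemma split_leave M M' S g g' p x :
  split_inv L M S g ->
  (forall v, M' (RX v) = M (RX v)) -> (forall v, M' (RY v) = M (RY v)) ->
  stopped g' = stopped g -> path_of g' = path_of g ->
  x <> Idle -> (forall i P d s, x <> Running (Split i P d s)) ->
  (forall i P, x <> Running (Door i P)) ->
  split_inv L M' (upd S p x) g'.
Proof.
  intros HI HX HY Hs Hp Hx Hx1 Hx2.
  assert (HN : prefix_node g' = prefix_node g) by (unfold prefix_node; rewrite Hp; reflexivity).
  split; rewrite ?HN, ?Hs; intros *; rewrite ?HX, ?HY; intros;
    split_cases; try solve [exfalso; eapply Hx1; eauto | exfalso; eapply Hx2; eauto].
  - eapply (stopped_Y _ _ _ _ HI); eauto.
  - eapply (late_Y _ _ _ _ HI); eauto.
  - eapply (stopped_X _ _ _ _ HI); eauto.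
  - eapply (late_X _ _ _ _ HI); eauto.
  - eapply (split_Y _ _ _ _ HI); eauto.
  - eapply (door_Y _ _ _ _ HI); eauto.
  - destruct (visited _ _ _ _ HI v q) as [H1 (d & H2 & H3)]; auto.
    eauto using nonidle_upd.
  - apply collided_upd with g; auto. eapply (split_collided _ _ _ _ HI); eauto.
Qed.

Lemma split_enter M S g p :
  split_inv L M S g -> at_door S p ->
  split_inv L M (upd S p (Running (Split p (path_of g p) 0 WriteX))) g.
Proof.
  intros HI Hd.
  split; intros; split_cases; try (intuition congruence).
  - eapply (stopped_Y _ _ _ _ HI); eauto.
  - eapply (late_Y _ _ _ _ HI); eauto.
  - eapply (stopped_X _ _ _ _ HI); eauto.
  - eapply (late_X _ _ _ _ HI); eauto.
  (* No Y register holds the name of a process that is still at the door. *)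
  - exfalso. eapply (door_Y _ _ _ _ HI); eauto.
  - eapply (split_Y _ _ _ _ HI); eauto.
  - eapply (door_Y _ _ _ _ HI); eauto.
  - destruct (visited _ _ _ _ HI v q) as [H1 (d & H2 & H3)]; auto.
    split; eauto. apply nonidle_upd; congruence.
  - apply collided_upd with g; auto; [congruence|]. eapply (split_collided _ _ _ _ HI); eauto.
Qed.

Ltac reg_cases :=
  unfold upd_reg in *;
  repeat match goal with
  | H : context [reg_eq_dec ?a ?b] |- _ => destruct (reg_eq_dec a b); try discriminate
  | |- context [reg_eq_dec ?a ?b] => destruct (reg_eq_dec a b); try discriminate
  end;
  repeat match goal with
  | H : RX _ = RX _ |- _ => injection H as H
  | H : RY _ = RY _ |- _ => injection H as H
  | H : RX _ <> RX _ |- _ => assert (Hneq := fun E => H (f_equal RX E)); clear H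
  end.

(** * Preservation of the splitter invariant inside a splitter *)

Section SplitterSteps.
Variables (M : reg -> nat) (S : nat -> status) (g : ghost) (p d : nat).
Hypothesis HI : split_inv L M S g.
Hypothesis Hlen : forall q, S q <> Idle -> length (path_of g q) = L.
Hypothesis Hd : (d <= L)%nat.

Notation P := (path_of g p).
Notation nd := (prefix_node g p d).

Lemma log2_prefix_node : S p <> Idle -> Nat.log2 nd = d.
Proof.
  intros H. unfold prefix_node. rewrite log2_node, length_firstn, Hlen by exact H. lia.
Qed.

Lemma split_write_X :
  S p = Running (Split p P d WriteX) ->
  split_inv L (upd_reg M (RX nd) (Datatypes.S p)) (upd S p (Running (Split p P d ReadY))) g.
Proof.
  intros Hp. assert (Hs : splitting S p d WriteX) by (exists p, P; exact Hp).
  split; intros; split_cases; try (intuition congruence).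
  - reg_cases. eapply (stopped_Y _ _ _ _ HI); eauto.
  - reg_cases. eapply (late_Y _ _ _ _ HI); eauto.
  (* X now names the writer, which is at [ReadY]; the late process in question is another one. *)
  - reg_cases; try congruence. eapply (stopped_X _ _ _ _ HI); eauto.
  - reg_cases; congruence.
  - reg_cases; try congruence. eapply (late_X _ _ _ _ HI); eauto.
  - reg_cases. left. destruct (split_Y _ _ _ _ HI _ _ _ _ Hs H0) as [|[]]; [auto|discriminate].
  - reg_cases. eapply (split_Y _ _ _ _ HI); eauto.
  - reg_cases. eapply (door_Y _ _ _ _ HI); eauto.
  - assert (Hv : (q = p /\ v = nd) \/ (M (RX v) = Datatypes.S q \/ M (RY v) = Datatypes.S q)).
    { reg_cases; intuition congruence. }
    destruct Hv as [[-> ->]|Hv].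
    + split; [rewrite upd_eq; discriminate | eauto].
    + destruct (visited _ _ _ _ HI v q Hv) as [H1 (d' & H2 & H3)].
      split; eauto. apply nonidle_upd; congruence.
  - apply collided_upd with g; auto; [discriminate|]. eapply (split_collided _ _ _ _ HI); eauto.
  - apply collided_upd with g; auto; [discriminate|]. eapply (split_collided _ _ _ _ HI); eauto.
Qed.

Lemma split_read_Y :
  S p = Running (Split p P d ReadY) -> M (RY nd) = 0%nat ->
  split_inv L M (upd S p (Running (Split p P d WriteY))) g.
Proof.
  intros Hp Hv. assert (Hs : splitting S p d ReadY) by (exists p, P; exact Hp).
  split; intros; split_cases; try (intuition congruence).
  - eapply (stopped_Y _ _ _ _ HI); eauto.
  - eapply (late_Y _ _ _ _ HI); eauto.
  (* A node that has stopped somebody has Y set, so reading 0 rules this case out. *)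
  - exfalso. eapply (stopped_Y _ _ _ _ HI); eauto. congruence.
  - eapply (stopped_X _ _ _ _ HI); eauto.
  - eapply (late_X _ _ _ _ HI); [exact Hs | discriminate].
  - eapply (late_X _ _ _ _ HI); eauto.
  - left. destruct (split_Y _ _ _ _ HI _ _ _ _ Hs H0) as [|[]]; [auto|discriminate].
  - eapply (split_Y _ _ _ _ HI); eauto.
  - eapply (door_Y _ _ _ _ HI); eauto.
  - destruct (visited _ _ _ _ HI v q H) as [H1 (d' & H2 & H3)].
    split; eauto. apply nonidle_upd; congruence.
  - apply collided_upd with g; auto; [discriminate|]. eapply (split_collided _ _ _ _ HI); eauto.
  - apply collided_upd with g; auto; [discriminate|]. eapply (split_collided _ _ _ _ HI); eauto.
Qed.

Lemma split_write_Y :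
  S p = Running (Split p P d WriteY) ->
  split_inv L (upd_reg M (RY nd) (Datatypes.S p)) (upd S p (Running (Split p P d ReadX))) g.
Proof.
  intros Hp. assert (Hs : splitting S p d WriteY) by (exists p, P; exact Hp).
  assert (Hlog : Nat.log2 nd = d) by (apply log2_prefix_node; congruence).
  split; intros; split_cases; try (intuition congruence).
  - reg_cases; try discriminate. eapply (stopped_Y _ _ _ _ HI); eauto.
  - reg_cases; congruence.
  - reg_cases; try discriminate. eapply (late_Y _ _ _ _ HI); eauto.
  - reg_cases. eapply (stopped_X _ _ _ _ HI); eauto.
  - reg_cases. eapply (stopped_X _ _ _ _ HI); eauto.
  - reg_cases. eapply (late_X _ _ _ _ HI); eauto. discriminate.
  - reg_cases. eapply (late_X _ _ _ _ HI); eauto.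
  - reg_cases.
    + right. rewrite e. auto.
    + destruct (split_Y _ _ _ _ HI _ _ _ _ Hs H0) as [|[]]; [auto|discriminate].
  - reg_cases; try congruence. eapply (split_Y _ _ _ _ HI); eauto.
  - reg_cases; try congruence. eapply (door_Y _ _ _ _ HI); eauto.
  - assert (Hv : (q = p /\ v = nd) \/ (M (RX v) = Datatypes.S q \/ M (RY v) = Datatypes.S q)).
    { reg_cases; intuition congruence. }
    destruct Hv as [[-> ->]|Hv].
    + split; [rewrite upd_eq; discriminate | eauto].
    + destruct (visited _ _ _ _ HI v q Hv) as [H1 (d' & H2 & H3)].
      split; eauto. apply nonidle_upd; congruence.
  - apply collided_upd with g; auto; [discriminate|]. eapply (split_collided _ _ _ _ HI); eauto.
  - apply collided_upd with g; auto; [discriminate|]. eapply (split_collided _ _ _ _ HI); eauto.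
Qed.

(** By [visited] the node lies on the path of [q]; injectivity of [node] turns this into a common
    prefix, and the lengths identify its depth as [d]. *)
Lemma collided_visitor q :
  S p <> Idle -> q <> p -> M (RX nd) = Datatypes.S q \/ M (RY nd) = Datatypes.S q -> collided S g p d.
Proof.
  intros Hp Hq Hv. destruct (visited _ _ _ _ HI nd q Hv) as [H1 (d' & H2 & H3)].
  exists q. split; [exact Hq|]. split; [exact H1|].
  apply node_inj in H3. rewrite H3. f_equal.
  apply (f_equal (@length bool)) in H3. rewrite !length_firstn, !Hlen in H3 by assumption. lia.
Qed.

Lemma split_fail_Y :
  S p = Running (Split p P d ReadY) -> M (RY nd) <> 0%nat -> collided S g p d.
Proof.
  intros Hp Hv. destruct (M (RY nd)) as [|q] eqn:E; [congruence|].
  apply collided_visitor with q; [congruence| |auto]. intros ->.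
  (* The name read is not its own: at [ReadY], a process has written Y only at smaller depths. *)
  destruct (split_Y _ _ _ _ HI p d ReadY nd) as [H|[_ H]]; auto; [exists p, P; exact Hp| |discriminate].
  rewrite log2_prefix_node in H; [lia|congruence].
Qed.

Lemma split_fail_X :
  S p = Running (Split p P d ReadX) -> M (RX nd) <> Datatypes.S p -> collided S g p d.
Proof.
  intros Hp Hv. destruct (M (RX nd)) as [|q] eqn:E.
  - exfalso. eapply (late_X _ _ _ _ HI); eauto; [exists p, P; exact Hp | discriminate].
  - apply collided_visitor with q; [congruence| congruence |auto].
Qed.

Lemma split_descend s :
  S p = Running (Split p P d s) -> collided S g p d ->
  split_inv L M (upd S p (Running (Split p P (Datatypes.S d) WriteX))) g.
Proof.
  intros Hp Hc. assert (Hs : splitting S p d s) by (exists p, P; exact Hp).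
  split; intros; split_cases; try (intuition congruence).
  - eapply (stopped_Y _ _ _ _ HI); eauto.
  - eapply (late_Y _ _ _ _ HI); eauto.
  - eapply (stopped_X _ _ _ _ HI); eauto.
  - eapply (late_X _ _ _ _ HI); eauto.
  - left. destruct (split_Y _ _ _ _ HI _ _ _ _ Hs H0) as [|[]]; lia.
  - eapply (split_Y _ _ _ _ HI); eauto.
  - eapply (door_Y _ _ _ _ HI); eauto.
  - destruct (visited _ _ _ _ HI v q H) as [H1 (d' & H2 & H3)].
    split; eauto. apply nonidle_upd; congruence.
  - apply collided_upd with g; auto; discriminate.
  - apply collided_upd with g; auto; [discriminate|]. eapply (split_collided _ _ _ _ HI); eauto.
Qed.

Lemma split_stop g' o s :
  S p = Running (Split p P d ReadX) -> M (RX nd) = Datatypes.S p ->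
  path_of g' = path_of g -> (forall w, stopped g' w = true <-> w = nd \/ stopped g w = true) ->
  split_inv L M (upd S p (Running (Climb o s Start))) g'.
Proof.
  intros Hp Hv Hpath Hst. assert (Hs : splitting S p d ReadX) by (exists p, P; exact Hp).
  split; unfold prefix_node in *; rewrite ?Hpath; intros; rewrite ?Hst in *; split_cases.
  - destruct H as [->|H]; [eapply (late_Y _ _ _ _ HI); eauto | eapply (stopped_Y _ _ _ _ HI); eauto].
  - eapply (late_Y _ _ _ _ HI); eauto.
  (* X holds the name of [p], so every other late process at this node has lost X. *)
  - destruct H as [->|H]; [congruence | eapply (stopped_X _ _ _ _ HI); eauto].
  - eapply (late_X _ _ _ _ HI); eauto.
  - eapply (split_Y _ _ _ _ HI); eauto.
  - eapply (door_Y _ _ _ _ HI); eauto.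
  - destruct (visited _ _ _ _ HI v q H) as [H1 (d' & H2 & H3)].
    unfold prefix_node in H3.
    split; eauto. apply nonidle_upd; congruence.
  - apply collided_upd with g; auto; [discriminate|]. eapply (split_collided _ _ _ _ HI); eauto.
Qed.

End SplitterSteps.

End Preservation.

(** * Preservation of the duel invariant *)

Section DuelSteps.
Variables n L : nat.

Notation status := (Status pstate).

Lemma climbing_upd_other (S : nat -> status) p x q o s :
  q <> p -> climbing S q o s -> climbing (upd S p x) q o s.
Proof. intros Hq [a Ha]. exists a. rewrite upd_neq; auto. Qed.

Lemma entered_upd (S : nat -> status) p x q :
  entered S q -> (entered S p -> entered (fun _ => x) p) -> entered (upd S p x) q.
Proof.
  intros Hq Hx. destruct (Nat.eq_dec q p) as [->|H].
  - destruct (Hx Hq) as (H1 & H2 & H3). unfold entered, at_door, splitting in *.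
    rewrite upd_eq. auto.
  - destruct Hq as (H1 & H2 & H3). unfold entered, at_door, splitting in *.
    rewrite upd_neq; auto.
Qed.

Lemma justified_mono (S S' : nat -> status) g g' o s :
  (forall o, won g o -> won g' o) -> (forall v, stopped g v = true -> stopped g' v = true) ->
  (forall q, entered S q -> entered S' q) ->
  justified L S g o s -> justified L S' g' o s.
Proof.
  intros H1 H2 H3. destruct o as [u|v|v]; simpl; auto.
  - destruct (Nat.eqb _ 0); auto. destruct (Nat.ltb _ _); auto.
  - destruct s; auto.
Qed.

(** For steps outside the duels. Only the justification of a backup leaf depends on such a step,
    hence the hypothesis that [entered] persists. *)
Lemma duel_frame M M' S g g' p x :
  duel_inv L M S g ->
  (forall o s, M' (RDuel o s) = M (RDuel o s)) ->
  duel_of g' = duel_of g -> (forall v, stopped g v = true -> stopped g' v = true) ->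
  (forall o s a, S p <> Running (Climb o s a)) -> S p <> Done false ->
  (forall o s a, x <> Running (Climb o s a)) -> x <> Done false ->
  (entered S p -> entered (fun _ => x) p) ->
  duel_inv L M' (upd S p x) g'.
Proof.
  intros HI HM HD Hst HS1 HS2 Hx1 Hx2 Hent.
  assert (Hcl : forall q o s, climbing (upd S p x) q o s <-> climbing S q o s).
  { intros q o s. split; intros H.
    - apply climbing_upd in H as [[-> [a H]]|[_ H]]; auto. exfalso. eapply Hx1; eauto.
    - apply climbing_upd_other; auto. intros ->. destruct H as [a H]. eapply HS1; eauto. }
  assert (Hdf : forall q, upd S p x q = Done false <-> S q = Done false).
  { intros q. destruct (Nat.eq_dec q p) as [->|H];
      [rewrite upd_eq; intuition | rewrite upd_neq by auto; reflexivity]. }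
  assert (Htc : forall o s, touched (upd S p x) g' o s <-> touched S g o s).
  { intros o s. unfold touched. rewrite HD.
    split; (intros [H|[q H]]; [left; auto | right; exists q; apply Hcl; auto]). }
  assert (Hw : forall o, won g o <-> won g' o) by (intros o; unfold won; rewrite HD; reflexivity).
  split; rewrite ?HD; intros.
  - rewrite HM. apply (duel_mem _ _ _ _ HI).
  - apply (duel_compat _ _ _ _ HI).
  - apply (climb_ok _ _ _ _ HI p0). destruct (Nat.eq_dec p0 p) as [->|Hq];
      [rewrite upd_eq in H; exfalso; eapply Hx1; eauto | rewrite upd_neq in H; auto].
  - destruct (duel_owner _ _ _ _ HI o s) as [q Hq]; auto. exists q. apply Hcl. auto.
  - destruct (won_up _ _ _ _ HI o s H) as [[-> [q Hq]]|[Hr Ht]].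
    + left. split; auto. exists q. apply Hdf. auto.
    + right. split; auto. apply Htc. auto.
  - apply Hcl in H, H0. eapply (climb_unique _ _ _ _ HI); eauto.
  - apply Htc in H. apply (touched_justified _ _ _ _ HI) in H.
    apply (justified_mono S _ g); [intros; apply Hw; assumption | exact Hst | intros; apply entered_upd; auto | exact H].
  - apply Hw. apply Hdf in H. eapply (winner_won _ _ _ _ HI); eauto.
  - apply Hdf in H, H0. eapply (winner_unique _ _ _ _ HI); eauto.
Qed.

(** The move from the splitter tree into a slot. Duel states do not change, as the newcomer has
    written nothing; an untouched slot preserves uniqueness. *)
Lemma duel_enter M S g g' p d s0 o s :
  duel_inv L M S g -> splitting S p d s0 ->
  duel_of g' = duel_of g -> (forall v, stopped g v = true -> stopped g' v = true) ->
  obj_ok L o -> ~ touched S g o s ->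
  justified L (upd S p (Running (Climb o s Start))) g' o s ->
  duel_inv L M (upd S p (Running (Climb o s Start))) g'.
Proof.
  intros HI (i & P & Hp) HD Hst Hok Ht Hj.
  set (x := Running (Climb o s Start)) in *.
  assert (Hcl : forall q o' s', climbing S q o' s' -> climbing (upd S p x) q o' s').
  { intros q o' s' H. apply climbing_upd_other; auto. intros ->. destruct H as [a H]. congruence. }
  assert (Hcl' : forall q o' s', climbing (upd S p x) q o' s' ->
                 (q = p /\ o' = o /\ s' = s) \/ climbing S q o' s').
  { intros q o' s' H. apply climbing_upd in H as [[-> [a H]]|[_ H]]; auto.
    injection H as <- <- <-. auto. }
  assert (Hdf : forall q, upd S p x q = Done false <-> S q = Done false).
  { intros q. destruct (Nat.eq_dec q p) as [->|H];
      [rewrite upd_eq; unfold x; split; intros; congruence | rewrite upd_neq by auto; reflexivity]. }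
  assert (Htc : forall o' s', touched S g o' s' -> touched (upd S p x) g' o' s').
  { intros o' s' [H|[q H]]; [left; rewrite HD; auto | right; eauto]. }
  assert (Hw : forall o, won g o <-> won g' o)
    by (intros o'; unfold won; rewrite HD; reflexivity).
  assert (Hent : forall q, entered S q -> entered (upd S p x) q).
  { intros q Hq. apply entered_upd; auto. intros (_ & _ & H). exfalso.
    apply (H d s0). exists i, P. auto. }
  assert (HDs : duel_of g o s = Start).
  { destruct (duel_of g o s) eqn:E; auto; exfalso; apply Ht; left; congruence. }
  split; rewrite ?HD; intros.
  - apply (duel_mem _ _ _ _ HI).
  - apply (duel_compat _ _ _ _ HI).
  - destruct (Nat.eq_dec p0 p) as [->|Hq].
    + rewrite upd_eq in H. injection H as <- <- <-. auto.
    + rewrite upd_neq in H by auto. eapply (climb_ok _ _ _ _ HI); eauto.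
  - destruct (duel_owner _ _ _ _ HI o0 s1) as [q Hq]; auto. exists q. auto.
  - destruct (won_up _ _ _ _ HI o0 s1 H) as [[-> [q Hq]]|[Hr Ht']].
    + left. split; auto. exists q. apply Hdf. auto.
    + right. split; auto.
  - apply Hcl' in H, H0. destruct H as [(-> & -> & ->)|H], H0 as [(-> & Ho & Hs')|H0]; auto.
    + exfalso. apply Ht. right; eauto.
    + subst. exfalso. apply Ht. right; eauto.
    + eapply (climb_unique _ _ _ _ HI); eauto.
  - assert (Hc : (o0 = o /\ s1 = s) \/ touched S g o0 s1).
    { destruct H as [H|[q H]]; [rewrite HD in H; right; left; auto|].
      apply Hcl' in H as [(_ & -> & ->)|H]; auto. right; right; eauto. }
    destruct Hc as [[-> ->]|Hc]; auto.
    apply (touched_justified _ _ _ _ HI) in Hc.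
    apply (justified_mono S _ g); [intros; apply Hw; assumption | exact Hst | exact Hent | exact Hc].
  - apply Hw. apply Hdf in H. eapply (winner_won _ _ _ _ HI); eauto.
  - apply Hdf in H, H0. eapply (winner_unique _ _ _ _ HI); eauto.
Qed.

Lemma up_neq o s : o <> Backup 0 -> (fst (up o), snd (up o)) <> (o, s).
Proof. intros Hr H. injection H as H _. apply height_up in Hr. rewrite H in Hr. lia. Qed.

(** If the next slot were touched, [o] would be won already: not by [s], which is undecided, and not
    by the opponent, which is compatible with [Won]. *)
Lemma up_untouched M S g o s a :
  duel_inv L M S g -> obj_ok L o -> o <> Backup 0 ->
  duel_of g o s = a -> undecided a = true -> compat Won (duel_of g o (negb s)) ->
  ~ touched S g (fst (up o)) (snd (up o)).
Proof.
  intros HI Hok Hr Ha Hu Hc Ht. apply (touched_justified _ _ _ _ HI) in Ht.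
  apply justified_up in Ht as [s' Hs']; auto.
  destruct (bool_dec s' s) as [->|Hs]; [rewrite <- Ha, Hs' in Hu; discriminate|].
  assert (s' = negb s) as -> by (destruct s, s'; simpl; congruence).
  apply compat_Won in Hc. contradiction.
Qed.

Definition with_duel (g : ghost) (o : obj) (s : bool) (a : duel) : ghost :=
  {| duel_of := upd_duel (duel_of g) o s a; stopped := stopped g; path_of := path_of g |}.

(** One treatment of all duel moves: staying in the duel, climbing after a win, winning the final,
    losing. In each case the old slot remains touched because [a'] is not [Start]. *)
Lemma duel_move M M' S g p o s a a' :
  duel_inv L M S g -> S p = Running (Climb o s a) ->
  compat a' (duel_of g o (negb s)) -> a' <> Start ->
  (forall o' s', M' (RDuel o' s') = duel_reg (upd_duel (duel_of g) o s a' o' s')) ->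
  duel_inv L M' (upd S p (settle (after_duel o s a'))) (with_duel g o s a').
Proof.
  intros HI Hp Hc Ha' HM.
  destruct (climb_ok _ _ _ _ HI _ _ _ _ Hp) as (Hok & Hu & Ha).
  assert (Hpc : climbing S p o s) by (exists a; auto).
  set (x := settle (after_duel o s a')). set (g' := with_duel g o s a').
  assert (HDe : duel_of g' o s = a') by apply upd_duel_eq.
  assert (HDn : forall o' s', (o', s') <> (o, s) -> duel_of g' o' s' = duel_of g o' s')
    by (intros; apply upd_duel_neq; auto).
  assert (Hslot : forall o' s', {(o', s') = (o, s)} + {(o', s') <> (o, s)}).
  { intros o' s'. destruct (obj_eq_dec o' o), (bool_dec s' s);
      (left; congruence) || (right; congruence). }
  assert (Hwon : forall o' s', duel_of g o' s' = Won -> duel_of g' o' s' = Won).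
  { intros o' s' H. destruct (Hslot o' s') as [E|E]; [|rewrite HDn; auto].
    injection E as -> ->. exfalso. rewrite <- Ha, H in Hu. discriminate. }
  assert (Hw : forall o', won g o' -> won g' o') by (intros o' [s' H]; exists s'; auto).
  assert (Hcl : forall q o' s', climbing S q o' s' -> (o', s') <> (o, s) ->
                climbing (upd S p x) q o' s').
  { intros q o' s' H Hn. apply climbing_upd_other; auto. intros ->. destruct H as [b H].
    rewrite Hp in H. injection H as <- <- <-. apply Hn. reflexivity. }
  assert (Hdf : forall q, S q = Done false -> upd S p x q = Done false).
  { intros q H. rewrite upd_neq; auto. intros ->. congruence. }
  assert (Htc : forall o' s', touched S g o' s' -> touched (upd S p x) g' o' s').
  { intros o' s' H. destruct (Hslot o' s') as [E|E].
    - injection E as -> ->. left. congruence.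
    - destruct H as [H|[q H]]; [left; rewrite HDn; auto | right; eauto]. }
  assert (Hent : forall q, entered S q -> entered (upd S p x) q).
  { intros q Hq. apply entered_upd; auto. intros _. unfold entered, at_door, splitting, x.
    destruct a'; simpl; try destruct (obj_eq_dec _ _); simpl;
      (split; [|split]); try discriminate; [intros (?&?&?)|intros ? ? (?&?&?)| ..];
      try discriminate; try (intros (?&?&?); discriminate);
      try (intros ? ? (?&?&?); discriminate). }
  (* The climbers after the move are the others, [p] in its old slot, or [p] in the slot above. *)
  assert (Hnew : forall q o' s' b, upd S p x q = Running (Climb o' s' b) ->
            (q <> p /\ S q = Running (Climb o' s' b) /\ (o', s') <> (o, s)) \/
            (q = p /\ undecided a' = true /\ o' = o /\ s' = s /\ b = a') \/
            (q = p /\ a' = Won /\ o <> Backup 0 /\ o' = fst (up o) /\ s' = snd (up o) /\ b = Start)).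
  { intros q o' s' b H. destruct (Nat.eq_dec q p) as [->|Hq].
    - right. rewrite upd_eq in H. unfold x in H.
      destruct a'; simpl in H; try (injection H as <- <- <-; left; auto; fail); try discriminate.
      destruct (obj_eq_dec o (Backup 0)); simpl in H; [discriminate|].
      injection H as <- <- <-. right. auto 7.
    - left. rewrite upd_neq in H by auto. split; [auto|split; [auto|]].
      intros E. injection E as -> ->. apply Hq.
      eapply (climb_unique _ _ _ _ HI); eauto. exists b; auto. }
  assert (Hup : a' = Won -> o <> Backup 0 -> ~ touched S g (fst (up o)) (snd (up o))).
  { intros Hw' Hr. rewrite Hw' in Hc. eapply up_untouched; eauto. }
  assert (Hdone : forall q, upd S p x q = Done false ->
            S q = Done false \/ (q = p /\ a' = Won /\ o = Backup 0)).
  { intros q H. destruct (Nat.eq_dec q p) as [->|Hq]; [|rewrite upd_neq in H; auto].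
    right. rewrite upd_eq in H. unfold x in H.
    destruct a'; simpl in H; try discriminate.
    destruct (obj_eq_dec o (Backup 0)); simpl in H; [auto|discriminate]. }
  split; intros.
  - apply HM.
  - destruct (obj_eq_dec o0 o) as [->|Ho]; [|rewrite !HDn by congruence; apply (duel_compat _ _ _ _ HI)].
    destruct s; rewrite HDe, HDn by congruence; [apply compat_sym|]; exact Hc.
  - destruct (Hnew _ _ _ _ H) as [(H1 & H2 & H3)|[(-> & H1 & -> & -> & ->)|(-> & H1 & H2 & -> & -> & ->)]].
    + rewrite HDn by auto. eapply (climb_ok _ _ _ _ HI); eauto.
    + auto.
    + split; [apply up_ok; auto|split; auto]. rewrite HDn by (apply up_neq; auto).
      destruct (duel_of g (fst (up o)) (snd (up o))) eqn:E; auto;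
        exfalso; apply Hup; auto; left; congruence.
  - destruct (Hslot o0 s0) as [E|E].
    + injection E as -> ->. rewrite HDe in H. exists p, a'. rewrite upd_eq.
      unfold x. destruct a'; try discriminate; reflexivity.
    + rewrite HDn in * by auto. destruct (duel_owner _ _ _ _ HI o0 s0) as [q Hq]; eauto.
  - destruct (Hslot o0 s0) as [E|E].
    + injection E as -> ->. rewrite HDe in H.
      destruct (obj_eq_dec o (Backup 0)) as [Hr|Hr]; [left|right]; split; auto.
      * exists p. rewrite upd_eq. unfold x. rewrite H. simpl. destruct (obj_eq_dec o (Backup 0)); tauto.
      * right. exists p, Start. rewrite upd_eq. unfold x. rewrite H. simpl.
        destruct (obj_eq_dec o (Backup 0)); tauto.
    + rewrite HDn in H by auto.
      destruct (won_up _ _ _ _ HI o0 s0 H) as [[-> [q Hq]]|[Hr Ht]]; [left|right]; eauto.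
  - destruct H as [b1 H1], H0 as [b2 H2]. apply Hnew in H1, H2.
    destruct H1 as [(A1 & A2 & A3)|[(-> & A1 & -> & -> & ->)|(-> & A1 & A2 & -> & -> & ->)]];
    destruct H2 as [(B1 & B2 & B3)|[(-> & B1 & B4 & B5 & ->)|(-> & B1 & B2 & B4 & B5 & ->)]]; auto;
      try (exfalso; congruence).
    + eapply (climb_unique _ _ _ _ HI); eexists; eauto.
    + rewrite B4, B5 in *. exfalso. apply Hup; auto. right. exists p0, b1. auto.
    + exfalso. apply Hup; auto. right. exists q, b2. auto.
  - assert (Hcs : touched S g o0 s0 \/
                  (a' = Won /\ o <> Backup 0 /\ o0 = fst (up o) /\ s0 = snd (up o))).
    { destruct (Hslot o0 s0) as [E|E].
      - injection E as -> ->. left; right; eauto.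
      - destruct H as [H|[q [b H]]].
        + rewrite HDn in H by auto. left; left; auto.
        + apply Hnew in H as [(H1 & H2 & H3)|[(-> & H1 & -> & -> & ->)|(-> & H1 & H2 & -> & -> & ->)]];
            [left; right; exists q, b; auto | congruence | auto 6]. }
    destruct Hcs as [Ht|(Hw' & Hr & -> & ->)].
    + apply (touched_justified _ _ _ _ HI) in Ht. eapply justified_mono; eauto.
    + apply justified_up; auto. exists s. congruence.
  - apply Hdone in H as [H|(-> & Hw' & ->)].
    + apply Hw. eapply (winner_won _ _ _ _ HI); eauto.
    + exists s. congruence.
  (* An earlier winner would mean that the final was already won, by [p] or by its opponent, and
     both are excluded. *)
  - assert (Huniq : forall q, S q = Done false -> a' = Won -> o = Backup 0 -> False).
    { intros r Hr Hw' ->. rewrite Hw' in Hc. apply (winner_won _ _ _ _ HI) in Hr as [s' Hs'].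
      destruct (bool_dec s' s) as [->|Hs]; [rewrite <- Ha, Hs' in Hu; discriminate|].
      assert (s' = negb s) as -> by (destruct s, s'; simpl; congruence).
      apply compat_Won in Hc. contradiction. }
    apply Hdone in H, H0. destruct H as [H|(-> & A1 & A2)], H0 as [H0|(-> & B1 & B2)]; auto;
      try (exfalso; eauto; fail).
    eapply (winner_unique _ _ _ _ HI); eauto.
Qed.

End DuelSteps.

(** * Finite sums and expectations *)

Fixpoint Rsum (n : nat) (f : nat -> R) : R :=
  match n with O => 0 | S n => Rsum n f + f n end.

Lemma Rsum_le n f f' : (forall i, (i < n)%nat -> f i <= f' i) -> Rsum n f <= Rsum n f'.
Proof.
  induction n as [|n IH]; intros H; simpl; [lra|].
  apply Rplus_le_compat; [apply IH; intros; apply H; lia | apply H; lia].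
Qed.

Lemma Rsum_ext n f f' : (forall i, (i < n)%nat -> f i = f' i) -> Rsum n f = Rsum n f'.
Proof. intros H. apply Rle_antisym; apply Rsum_le; intros; rewrite H by auto; lra. Qed.

Lemma Rsum_plus n f f' : Rsum n (fun i => f i + f' i) = Rsum n f + Rsum n f'.
Proof. induction n; simpl; lra. Qed.

Lemma Rsum_scal n a f : Rsum n (fun i => a * f i) = a * Rsum n f.
Proof. induction n; simpl; lra. Qed.

Lemma Rsum_0 n : Rsum n (fun _ => 0) = 0.
Proof. induction n; simpl; lra. Qed.

Lemma Rsum_nonneg n f : (forall i, (i < n)%nat -> 0 <= f i) -> 0 <= Rsum n f.
Proof. intros H. rewrite <- (Rsum_0 n). apply Rsum_le. exact H. Qed.

Lemma Rsum_indicator n p a : (p < n)%nat -> Rsum n (fun i => if Nat.eqb i p then a else 0) = a.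
Proof.
  induction n as [|n IH]; intros H; [lia|]. simpl. destruct (Nat.eqb_spec n p) as [->|Hn].
  - rewrite (Rsum_ext _ _ (fun _ => 0)); [rewrite Rsum_0; lra|].
    intros i Hi. destruct (Nat.eqb_spec i p); [lia|auto].
  - rewrite IH by lia. lra.
Qed.

Lemma Rsum_term n f p : (p < n)%nat -> (forall i, (i < n)%nat -> 0 <= f i) -> f p <= Rsum n f.
Proof.
  intros Hp H. rewrite <- (Rsum_indicator n p (f p)) by auto. apply Rsum_le.
  intros i Hi. destruct (Nat.eqb_spec i p) as [->|]; auto. lra.
Qed.

Definition Ex {X : Type} (d : list (R * X)) (F : X -> R) : R :=
  fold_right Rplus 0 (map (fun x => fst x * F (snd x)) d).

Section Expectation.
Context {X : Type}.
Implicit Types (d : list (R * X)) (F : X -> R).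

Lemma Ex_le d F F' :
  Forall (fun x => 0 <= fst x /\ F (snd x) <= F' (snd x)) d -> Ex d F <= Ex d F'.
Proof.
  unfold Ex. induction 1 as [|x d [H1 H2] _ IH]; simpl; [lra|].
  apply Rplus_le_compat; auto. apply Rmult_le_compat_l; auto.
Qed.

Lemma Ex_plus d F F' : Ex d (fun x => F x + F' x) = Ex d F + Ex d F'.
Proof. unfold Ex. induction d; simpl; lra. Qed.

Lemma Ex_scal d a F : Ex d (fun x => a * F x) = a * Ex d F.
Proof. unfold Ex. induction d; simpl; lra. Qed.

Lemma Ex_const d a : fold_right Rplus 0 (map fst d) = 1 -> Ex d (fun _ => a) = a.
Proof.
  intros H. transitivity (a * fold_right Rplus 0 (map fst d)); [|rewrite H; lra].
  clear H. unfold Ex. induction d; simpl; lra.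
Qed.

Lemma Ex_Rsum d n (F : nat -> X -> R) :
  Ex d (fun x => Rsum n (fun i => F i x)) = Rsum n (fun i => Ex d (F i)).
Proof.
  induction n as [|n IH]; simpl.
  - unfold Ex. induction d; simpl; lra.
  - rewrite Ex_plus, IH. reflexivity.
Qed.

Lemma Ex_map {Y : Type} (d : list (R * Y)) (h : Y -> X) F :
  Ex (map (fun x => (fst x, h (snd x))) d) F = Ex d (fun y => F (h y)).
Proof. unfold Ex. rewrite map_map. reflexivity. Qed.

End Expectation.

(** * Collisions of random paths *)

(** About [(3/2) ^ l] for the length [l] of the longest common prefix; below 2, the base keeps the
    mean under a uniformly random path bounded. *)
Fixpoint overlap (P Q : list bool) : R :=
  match P, Q with
  | a :: P, b :: Q => if Bool.eqb a b then 3/2 * overlap P Q else 1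
  | _, _ => 2
  end.

Lemma overlap_sym P Q : overlap P Q = overlap Q P.
Proof.
  revert Q. induction P as [|a P IH]; intros [|b Q]; simpl; auto.
  destruct a, b; simpl; rewrite ?IH; reflexivity.
Qed.

Lemma overlap_ge_1 P Q : 1 <= overlap P Q.
Proof.
  revert Q. induction P as [|a P IH]; intros [|b Q]; simpl; try lra.
  destruct (Bool.eqb a b); [specialize (IH Q)|]; lra.
Qed.

Lemma overlap_prefix d P Q :
  (d <= length P)%nat -> firstn d P = firstn d Q -> (3/2) ^ d <= overlap P Q.
Proof.
  revert P Q. induction d as [|d IH]; intros P Q Hd H; [apply overlap_ge_1|].
  destruct P as [|a P]; [simpl in Hd; lia|]. destruct Q as [|b Q]; [discriminate|].
  simpl in *. injection H as -> H. rewrite Bool.eqb_reflx.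
  apply Rmult_le_compat_l; [lra|]. apply IH; [lia|auto].
Qed.

Lemma Ex_random_path_S l F :
  Ex (random_path (S l)) F =
  (Ex (random_path l) (fun P => F (false :: P)) + Ex (random_path l) (fun P => F (true :: P))) / 2.
Proof.
  simpl. unfold Ex. rewrite map_app, !map_map. simpl.
  assert (H : forall (G : list bool -> R) a (d : dist (list bool)),
    fold_right Rplus a (map (fun x => fst x / 2 * G (snd x)) d) =
    a + fold_right Rplus 0 (map (fun x => fst x * G (snd x)) d) / 2).
  { intros G a d. induction d as [|x d IH]; simpl; lra. }
  rewrite fold_right_app, (H (fun P => F (true :: P))), (H (fun P => F (false :: P))). lra.
Qed.

(** With probability 1/2 the paths part at the first bit, otherwise the rest is scaled by 3/2. The
    bound 2 is the fixed point of [m = 1/2 + 3/4 * m], which is why [overlap] is 2 on exhausted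
    paths. *)
Lemma Ex_overlap l Q : Ex (random_path l) (fun P => overlap P Q) <= 2.
Proof.
  revert Q. induction l as [|l IH]; intros Q; [unfold Ex; simpl; lra|].
  rewrite Ex_random_path_S. destruct (random_path_ok l) as [_ H1].
  destruct Q as [|[] Q]; simpl.
  - rewrite !Ex_const by exact H1. lra.
  - rewrite Ex_const by exact H1. rewrite Ex_scal. specialize (IH Q). lra.
  - rewrite Ex_const by exact H1. rewrite Ex_scal. specialize (IH Q). lra.
Qed.

(** * The potential *)

Section Potential.
Variables n L : nat.

Notation status := (Status pstate).

Definition pair_pot (S : nat -> status) (g : ghost) (p q : nat) : R :=
  if Nat.eqb q p then 0 else if is_idle (S q) then 0 else overlap (path_of g p) (path_of g q).

(** The factor 3 comes from [2 * (3/2) ^ (d + 1) = 3 * (3/2) ^ d]: a collision on a prefix of length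
    [d] must pay for leaving the tree at depth [d + 1]. The summand 1 pays for depth 0. *)
Definition descent_pot (S : nat -> status) (g : ghost) (p : nat) : R :=
  3 * (1 + Rsum n (pair_pot S g p)).

(** Bounds the expectation of [1.01 ^ t] for the final number [t] of steps of [p]. *)
Definition pot (S : nat -> status) (T : nat -> nat) (g : ghost) (p : nat) : R :=
  match S p with
  | Idle => 0
  | Done _ => 1.01 ^ T p
  | Running (Door _ _) | Running (Split _ _ _ _) => descent_pot S g p
  | Running (Climb o s a) =>
      1.01 ^ (Datatypes.S (T p)) * 1.2 ^ height o * duel_potR a (duel_of g o (negb s))
  | Running CloseDoor => 1.01 ^ (Datatypes.S (T p))
  | Running (Exit _) => 0
  end.

Definition invoked (S : nat -> status) : R := Rsum n (fun p => if is_idle (S p) then 0 else 1).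

(** The second term is a reserve for future invocations. With [J] processes present, the next one
    adds at most [3 + 12 * J] in the mean and releases [6 * ((J + 1) ^ 2 - J ^ 2) = 12 * J + 6]. *)
Definition total_pot (k : nat) (S : nat -> status) (T : nat -> nat) (g : ghost) : R :=
  Rsum n (pot S T g) + 6 * (INR k ^ 2 - invoked S ^ 2).

Lemma pair_pot_nonneg S g p q : 0 <= pair_pot S g p q.
Proof.
  unfold pair_pot. destruct (Nat.eqb q p); [lra|]. destruct (is_idle (S q)); [lra|].
  pose proof (overlap_ge_1 (path_of g p) (path_of g q)). lra.
Qed.

Lemma descent_pot_ge S g p : 3 <= descent_pot S g p.
Proof.
  unfold descent_pot.
  pose proof (Rsum_nonneg n (pair_pot S g p) (fun q _ => pair_pot_nonneg S g p q)). lra.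
Qed.

Lemma collided_pot S T g p d :
  local_inv n L S T g -> (d <= L)%nat -> S p <> Idle -> collided S g p d ->
  3 * (3/2) ^ d <= descent_pot S g p.
Proof.
  intros HI Hd Hp (q & Hq & Hqi & Hqp). unfold descent_pot.
  destruct (local_nonidle _ _ _ _ _ _ (HI p) Hp) as [_ Hlen].
  destruct (local_nonidle _ _ _ _ _ _ (HI q) Hqi) as [Hqn _].
  assert (H1 : (3/2) ^ d <= pair_pot S g p q).
  { unfold pair_pot. apply Nat.eqb_neq in Hq. rewrite Hq.
    replace (is_idle (S q)) with false by (destruct (S q); simpl; congruence).
    apply overlap_prefix; [lia|auto]. }
  pose proof (Rsum_term n (pair_pot S g p) q Hqn (fun r _ => pair_pot_nonneg S g p r)). lra.
Qed.

Lemma pow_1_2_le a b : (a <= b)%nat -> 1.2 ^ a <= 1.2 ^ b.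
Proof. intros H. apply Rle_pow; [lra|auto]. Qed.

Lemma pow_1_01_le a b : (a <= b)%nat -> 1.01 ^ a <= 1.01 ^ b.
Proof. intros H. apply Rle_pow; [lra|auto]. Qed.

(** The bound [4 * d + 6] covers the door, [d + 1] splitters of four steps and the final closing of
    the door; the last factor 1.2 covers the first duel. Numerically [1.01 ^ 4 * 1.2 ^ 2 <= 3/2] per
    level, and [1.01 ^ 6 * 1.2 ^ 3 <= 2] for the rest. *)
Lemma cost_bound d t h :
  (t <= 4 * d + 6)%nat -> (h <= 2 * d + 2)%nat -> 1.01 ^ t * 1.2 ^ h * 1.2 <= 2 * (3/2) ^ d.
Proof.
  intros Ht Hh. apply Rle_trans with (1.01 ^ (4 * d + 6) * 1.2 ^ (2 * d + 2) * 1.2).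
  - apply Rmult_le_compat_r; [lra|].
    apply Rmult_le_compat; try (apply pow_le; lra); [apply pow_1_01_le | apply pow_1_2_le]; auto.
  - rewrite !pow_add, !pow_mult.
    replace ((1.01 ^ 4) ^ d * 1.01 ^ 6 * ((1.2 ^ 2) ^ d * 1.2 ^ 2) * 1.2)
      with ((1.01 ^ 4 * 1.2 ^ 2) ^ d * (1.01 ^ 6 * 1.2 ^ 3)) by (rewrite Rpow_mult_distr; ring).
    assert (H1 : (1.01 ^ 4 * 1.2 ^ 2) ^ d <= (3/2) ^ d) by (apply pow_incr; lra).
    assert (H2 : 0 <= (1.01 ^ 4 * 1.2 ^ 2) ^ d) by (apply pow_le; lra).
    assert (H3 : 0 <= 1.01 ^ 6 * 1.2 ^ 3 <= 2) by lra.
    nra.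
Qed.

Lemma descent_cost S T g p d t h :
  local_inv n L S T g -> (d <= Datatypes.S L)%nat -> S p <> Idle ->
  (d = 0%nat \/ exists d', d = Datatypes.S d' /\ collided S g p d') ->
  (t <= 4 * d + 6)%nat -> (h <= 2 * d + 2)%nat ->
  1.01 ^ t * 1.2 ^ h * 1.2 <= descent_pot S g p.
Proof.
  intros HI Hd Hp Hc Ht Hh. pose proof (cost_bound d t h Ht Hh) as H.
  destruct Hc as [->|(d' & -> & Hc)].
  - pose proof (descent_pot_ge S g p). simpl in H. lra.
  - pose proof (collided_pot S T g p d' HI ltac:(lia) Hp Hc). simpl in H. lra.
Qed.

End Potential.

(** * Steps of the system *)

Section Steps.
Variables n L : nat.

Notation status := (Status pstate).

Definition response (c : Config pstate) (s : pstate) : nat :=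
  match pact s with PRead r => regs c r | _ => 0%nat end.

Definition after (c : Config pstate) (p : nat) (s : pstate) (x : status) : Config pstate :=
  {| mem := match pact s with PWrite r v => upd (mem c) (addr r) v | _ => mem c end;
     stat := upd (stat c) p x;
     steps := upd (steps c) p (S (steps c p)) |}.

Lemma step_running k c p b s :
  (p < n)%nat -> stat c p = Running s -> state_ok L s -> (forall b, s <> Exit b) ->
  step (ratrace L) n k c (p, b) =
  map (fun ws => (fst ws, after c p s (mk_status (ratrace L) (snd ws)))) (pnext L s (response c s)).
Proof.
  intros Hp Hs Hok Hex. unfold step. change (st (ratrace L)) with pstate. apply Nat.ltb_lt in Hp. rewrite Hp, Hs.
  pose proof (compile_ok L _ (state_ok_action L s Hok)) as Hact.
  cbn [act ratrace]. rewrite Hact. unfold after, response.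
  destruct (pact s) as [r|r v|b'] eqn:E; try reflexivity.
  exfalso. destruct s as [? ?|? ? ? []|? ? a| |b0]; simpl in E; try discriminate.
  - destruct (duel_write a); discriminate.
  - eapply Hex; eauto.
Qed.

Lemma regs_after c p s x :
  regs (after c p s x) = match pact s with PWrite r v => upd_reg (regs c) r v | _ => regs c end.
Proof.
  unfold regs, after. simpl. destruct (pact s); auto. apply regs_upd.
Qed.

(** The facts about a single step needed for linearizability; the last clause says that one becomes
    a candidate only through an open door. *)
Definition trans (c c' : Config pstate) : Prop :=
  (regs c RDoor <> 0%nat -> regs c' RDoor <> 0%nat) /\
  forall q,
    (stat c' q = Idle -> stat c q = Idle) /\
    (forall b, stat c q = Done b -> stat c' q = Done b) /\
    (candidate (stat c') q -> candidate (stat c) q \/ regs c RDoor = 0%nat).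

(** The new history variables depend on the coin outcome, so the step is lifted to a distribution on
    pairs of a configuration and a ghost; on it the invariant holds and the mean potential does not
    grow. *)
Definition good_step (k : nat) (c : Config pstate) (g : ghost) (d : dist (Config pstate)) : Prop :=
  exists l : list (R * (Config pstate * ghost)),
    d = map (fun x => (fst x, fst (snd x))) l /\
    Forall (fun x => 0 <= fst x /\ inv n L (fst (snd x)) (snd (snd x)) /\
                     trans c (fst (snd x)) /\ (ninvoked pstate n (fst (snd x)) <= k)%nat) l /\
    fold_right Rplus 0 (map fst l) = 1 /\
    Ex l (fun cg => total_pot n k (stat (fst cg)) (steps (fst cg)) (snd cg))
      <= total_pot n k (stat c) (steps c) g.

Lemma trans_refl c : trans c c.
Proof. split; auto. Qed.

Lemma good_step_refl k c g :
  inv n L c g -> (ninvoked pstate n c <= k)%nat -> good_step k c g [(1, c)].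
Proof.
  intros HI Hk. exists [(1, (c, g))]. split; [reflexivity|].
  split; [|split; [simpl; lra | unfold Ex; simpl; lra]].
  constructor; [|constructor]. simpl. split; [lra|]. auto using trans_refl.
Qed.

Lemma ninvoked_ext (c c' : Config pstate) :
  (forall q, is_idle (stat c' q) = is_idle (stat c q)) ->
  ninvoked pstate n c' = ninvoked pstate n c.
Proof.
  intros H. unfold ninvoked. f_equal. apply filter_ext. intros q. rewrite H. reflexivity.
Qed.

Lemma is_idle_upd (S : nat -> status) p x :
  x <> Idle -> S p <> Idle -> forall q, is_idle (upd S p x q) = is_idle (S q).
Proof.
  intros Hx Hp q. destruct (Nat.eq_dec q p) as [->|H].
  - rewrite upd_eq. destruct x, (S p); simpl; congruence.
  - rewrite upd_neq by auto. reflexivity.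
Qed.

Lemma trans_after c p s x :
  stat c p = Running s -> x <> Idle ->
  (candidate (fun _ => x) p -> candidate (stat c) p \/ regs c RDoor = 0%nat) ->
  trans c (after c p s x).
Proof.
  intros Hs Hx Hc. split.
  - rewrite regs_after. destruct (pact s) as [r|r v|b] eqn:E; auto.
    unfold upd_reg. destruct (reg_eq_dec RDoor r) as [<-|]; auto.
    destruct s as [? ?|? ? ? []|? ? a| |b0]; simpl in E; try discriminate.
    + destruct (duel_write a); discriminate.
    + injection E as <-. discriminate.
  - intros q. unfold after, candidate in *. simpl.
    destruct (Nat.eq_dec q p) as [->|H]; [rewrite upd_eq | rewrite !upd_neq by auto; auto].
    rewrite Hs in *. split; [congruence|split; [discriminate|auto]].
Qed.

Lemma inv_after c g g' p s x :
  inv n L c g -> path_of g' = path_of g ->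
  (forall o s, duel_of g o s = Lost -> duel_of g' o s = Lost) ->
  local_at n L g' p x (S (steps c p)) ->
  (s = CloseDoor -> exists o s, duel_of g' o s = Lost) ->
  (x = Done true -> regs (after c p s x) RDoor <> 0%nat) ->
  split_inv L (regs (after c p s x)) (upd (stat c) p x) g' ->
  duel_inv L (regs (after c p s x)) (upd (stat c) p x) g' ->
  inv n L (after c p s x) g'.
Proof.
  intros [I1 [I2 I2'] I3 I4] Hpath Hlost Hloc Hclose Hdone Hsplit Hduel.
  assert (Hmono : s <> CloseDoor -> regs (after c p s x) RDoor = regs c RDoor).
  { intros Hs. rewrite regs_after. destruct (pact s) as [r|r v|b] eqn:E; auto.
    unfold upd_reg. destruct (reg_eq_dec RDoor r) as [<-|]; auto.
    destruct s as [? ?|? ? ? []|? ? a| |b0]; simpl in E; try discriminate; try congruence.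
    destruct (duel_write a); discriminate. }
  assert (Hcl : s = CloseDoor -> regs (after c p s x) RDoor <> 0%nat).
  { intros ->. rewrite regs_after. simpl. unfold upd_reg.
    destruct (reg_eq_dec RDoor RDoor); congruence. }
  assert (Hdec : s = CloseDoor \/ s <> CloseDoor) by apply classic.
  split; auto.
  - apply local_step with g; auto.
  - split.
    + intros H. destruct Hdec as [Hs|Hs]; auto. rewrite Hmono in H by auto.
      destruct (I2 H) as (o & s' & Hl). eauto.
    + intros q Hq. simpl in Hq. destruct (Nat.eq_dec q p) as [->|Hqp].
      * rewrite upd_eq in Hq. auto.
      * rewrite upd_neq in Hq by auto. destruct Hdec as [Hs|Hs]; auto.
        rewrite Hmono by auto. eauto.
Qed.

Lemma pair_pot_upd S g g' p x :
  x <> Idle -> S p <> Idle -> path_of g' = path_of g ->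
  pair_pot (upd S p x) g' = pair_pot S g.
Proof.
  intros Hx Hp Hpath. extensionality r. extensionality q. unfold pair_pot.
  rewrite is_idle_upd by auto. rewrite Hpath. reflexivity.
Qed.

Lemma invoked_upd S p x :
  x <> Idle -> S p <> Idle -> invoked n (upd S p x) = invoked n S.
Proof.
  intros Hx Hp. unfold invoked. apply Rsum_ext. intros q _.
  rewrite is_idle_upd by auto. reflexivity.
Qed.

Lemma pot_other S T g g' p x t r :
  x <> Idle -> S p <> Idle -> path_of g' = path_of g ->
  r <> p -> (forall o s a, S r = Running (Climb o s a) ->
             duel_of g' o (negb s) = duel_of g o (negb s)) ->
  pot n (upd S p x) (upd T p t) g' r = pot n S T g r.
Proof.
  intros Hx Hp Hpath Hr HD. unfold pot, descent_pot. rewrite pair_pot_upd with (g := g) by auto.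
  rewrite !upd_neq by auto. destruct (S r) as [|[]|] eqn:E; auto.
  erewrite HD by reflexivity. reflexivity.
Qed.

(** For deterministic steps that change no duel state, so that no other process changes its
    potential. *)
Lemma good_step_one k c g g' p s x :
  inv n L c g -> (ninvoked pstate n c <= k)%nat ->
  stat c p = Running s -> x <> Idle ->
  inv n L (after c p s x) g' ->
  path_of g' = path_of g -> duel_of g' = duel_of g ->
  (candidate (fun _ => x) p -> candidate (stat c) p \/ regs c RDoor = 0%nat) ->
  pot n (upd (stat c) p x) (upd (steps c) p (S (steps c p))) g' p <= pot n (stat c) (steps c) g p ->
  good_step k c g [(1, after c p s x)].
Proof.
  intros HI Hk Hs Hx HI' Hpath HD Hc Hpot.
  assert (Hsi : stat c p <> Idle) by congruence.
  exists [(1, (after c p s x, g'))]. split; [reflexivity|].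
  split; [|split; [simpl; lra|]].
  - constructor; [|constructor]. simpl. split; [lra|]. split; [auto|]. split.
    + apply trans_after; auto.
    + rewrite (ninvoked_ext c); auto. apply is_idle_upd; auto.
  - unfold Ex. simpl. rewrite Rplus_0_r, Rmult_1_l. unfold total_pot. rewrite invoked_upd by auto.
    apply Rplus_le_compat_r. apply Rsum_le. intros r _.
    destruct (Nat.eq_dec r p) as [->|Hr]; [exact Hpot|].
    rewrite pot_other with (g := g); auto; [lra|]. intros. rewrite HD. reflexivity.
Qed.

Definition mark_stopped (g : ghost) (v : nat) : ghost :=
  {| duel_of := duel_of g;
     stopped := fun w => if Nat.eqb w v then true else stopped g w;
     path_of := path_of g |}.

Lemma stat_nonclimb_frame c g p s x M' :
  inv n L c g -> stat c p = Running s ->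
  (forall o s', M' (RDuel o s') = regs c (RDuel o s')) ->
  (forall o s' a, s <> Climb o s' a) ->
  (forall o s' a, x <> Running (Climb o s' a)) -> x <> Done false ->
  (entered (stat c) p -> entered (fun _ => x) p) ->
  duel_inv L M' (upd (stat c) p x) g.
Proof.
  intros HI Hs HM Hs1 Hx1 Hx2 Hent. destruct HI as [_ _ _ HI].
  eapply duel_frame; eauto.
  - intros o s' a H. rewrite Hs in H. injection H as H. eapply Hs1; eauto.
  - congruence.
Qed.

End Steps.

(** * Invariant and potential under each kind of step *)

Section Cases.
Variables n L : nat.
Hypothesis HL : (1 <= L)%nat.
Hypothesis HnL : (n <= 2 ^ L)%nat.
Variables (k : nat) (c : Config pstate) (g : ghost) (p : nat).
Hypothesis HI : inv n L c g.
Hypothesis Hk : (ninvoked pstate n c <= k)%nat.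

Notation status := (Status pstate).
Notation P := (path_of g p).

Lemma inv_length q : stat c q <> Idle -> length (path_of g q) = L.
Proof. intros H. eapply local_nonidle; eauto. apply (inv_local _ _ _ _ HI). Qed.

(** The descent potential depends only on the random paths and on who has been invoked, not on depth
    or stage. *)
Lemma pot_split_step s x :
  stat c p = Running s ->
  (exists i P, s = Door i P) \/ (exists i P d st, s = Split i P d st) ->
  (exists i P d st, x = Running (Split i P d st)) ->
  pot n (upd (stat c) p x) (upd (steps c) p (S (steps c p))) g p = pot n (stat c) (steps c) g p.
Proof.
  intros Hs H1 (i & Q & d & st & ->). unfold pot. rewrite upd_eq, Hs.
  unfold descent_pot. rewrite pair_pot_upd with (g := g) by congruence.
  destruct H1 as [(i' & Q' & ->)|(i' & Q' & d' & st' & ->)]; reflexivity.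
Qed.

Lemma good_door :
  stat c p = Running (Door p P) ->
  good_step n L k c g
    [(1, after c p (Door p P)
           (settle (if Nat.eqb (regs c RDoor) 0 then Split p P 0 WriteX else Exit true)))].
Proof.
  intros Hs. pose proof (inv_local _ _ _ _ HI p) as Hloc. rewrite Hs in Hloc. simpl in Hloc.
  destruct Hloc as (Hp & Hlen & _ & _ & HT).
  destruct (Nat.eqb_spec (regs c RDoor) 0) as [Hv|Hv]; cbn [settle].
  - apply good_step_one with (g' := g); auto; try discriminate.
    + apply inv_after with (g := g); auto; try discriminate; rewrite ?regs_after; cbn [pact].
      * simpl. rewrite HT. split; [auto|]. split; [auto|]. repeat split; lia.
      * apply split_enter; [apply (inv_split _ _ _ _ HI)|]. exists p, P. auto.
      * apply (stat_nonclimb_frame n L c g p _ _ _ HI Hs); auto; try discriminate.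
        intros (_ & H & _). exfalso. apply H. exists p, P. auto.
    + apply Req_le. apply pot_split_step with (s := Door p P); eauto 10.
  - apply good_step_one with (g' := g); auto; try discriminate.
    + apply inv_after with (g := g); auto; try discriminate; rewrite ?regs_after; cbn [pact].
      * simpl. auto.
      * apply split_leave with (M := regs c) (g := g); try discriminate; auto.
        apply (inv_split _ _ _ _ HI).
      * apply (stat_nonclimb_frame n L c g p _ _ _ HI Hs); auto; try discriminate.
        intros (_ & H & _). exfalso. apply H. exists p, P. auto.
    + intros [].
    (* At a closed door the call ends after one step, and 1.01 is below the minimum 3 of the descent
       potential. *)
    + unfold pot at 1. rewrite !upd_eq, HT. unfold pot. rewrite Hs.
      pose proof (descent_pot_ge n (stat c) g p). lra.
Qed.

Lemma good_internal d st st' v :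
  stat c p = Running (Split p P d st) ->
  (st = WriteX /\ st' = ReadY \/ st = ReadY /\ st' = WriteY /\ v = 0%nat \/
   st = WriteY /\ st' = ReadX) ->
  (st = ReadY -> v = regs c (RY (prefix_node g p d))) ->
  good_step n L k c g [(1, after c p (Split p P d st) (settle (Split p P d st')))].
Proof.
  intros Hs Hst Hv. pose proof (inv_local _ _ _ _ HI p) as Hloc. rewrite Hs in Hloc. simpl in Hloc.
  destruct Hloc as (Hp & Hlen & _ & _ & Hd & HT). cbn [settle].
  assert (Hss : splitting (stat c) p d st) by (exists p, P; auto).
  pose proof inv_length as Hl.
  apply good_step_one with (g' := g); auto; try discriminate.
  - apply inv_after with (g := g); auto; try discriminate; rewrite ?regs_after.
    + simpl. repeat split; auto.
      destruct Hst as [[-> ->]|[[-> [-> _]]|[-> ->]]]; simpl in *; lia.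
    + destruct Hst as [[-> ->]|[[-> [-> ->]]|[-> ->]]]; cbn [pact].
      * apply split_write_X; auto; apply (inv_split _ _ _ _ HI).
      * apply split_read_Y; auto; try apply (inv_split _ _ _ _ HI). symmetry. auto.
      * apply split_write_Y; auto; apply (inv_split _ _ _ _ HI).
    + apply (stat_nonclimb_frame n L c g p _ _ _ HI Hs); try discriminate.
      * intros o s'. destruct Hst as [[-> ->]|[[-> [-> ->]]|[-> ->]]]; reflexivity.
      * intros (_ & _ & H). exfalso. eapply H; eauto.
  - left. unfold candidate. rewrite Hs. exact I.
  - apply Req_le. apply pot_split_step with (s := Split p P d st); eauto 10.
Qed.

Lemma entered_climb o s a : entered (fun _ => Running (Climb o s a)) p.
Proof.
  split; [discriminate|split].
  - intros (? & ? & ?). discriminate.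
  - intros ? ? (? & ? & ?). discriminate.
Qed.

(** Here the descent pays for the climb. [d0] is the depth charged: [d] for a process that stops,
    but [S L] for one that falls through depth [L], whose collision there provides the extra
    credit. *)
Lemma pot_enter_le g' d d0 st o s :
  stat c p = Running (Split p P d st) ->
  inv n L (after c p (Split p P d st) (Running (Climb o s Start))) g' ->
  (d <= d0 <= S L)%nat -> (height o <= 2 * d0 + 2)%nat ->
  (d0 = 0%nat \/ exists d', d0 = S d' /\ collided (stat c) g p d') ->
  pot n (upd (stat c) p (Running (Climb o s Start))) (upd (steps c) p (S (steps c p))) g' p
    <= pot n (stat c) (steps c) g p.
Proof.
  intros Hs HI' Hd Hh Hc. pose proof (inv_local _ _ _ _ HI p) as Hloc. rewrite Hs in Hloc.
  destruct Hloc as (_ & _ & _ & _ & _ & HT).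
  unfold pot at 1. rewrite !upd_eq. unfold pot. rewrite Hs.
  pose proof (inv_duel _ _ _ _ HI') as HD.
  assert (Ha : duel_of g' o s = Start).
  { eapply (climb_ok _ _ _ _ HD p). unfold after. simpl. apply upd_eq. }
  pose proof (compat_slots _ _ _ _ o s HD) as Hcs. rewrite Ha in Hcs.
  apply duel_potR_bounds in Hcs.
  apply Rle_trans with (1.01 ^ S (S (steps c p)) * 1.2 ^ height o * 1.2).
  - apply Rmult_le_compat_l; [|lra]. apply Rmult_le_pos; apply pow_le; lra.
  - apply descent_cost with (L := L) (T := steps c) (d := d0); auto; try lia.
    + apply (inv_local _ _ _ _ HI).
    + congruence.
    + destruct st; simpl in HT; lia.
Qed.

Lemma height_leaf : (p < n)%nat -> (height (fst (up (Backup (2 ^ L + p)))) <= L + 2)%nat.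
Proof.
  intros Hp. assert (Hlog : Nat.log2 (2 ^ L + p) = L).
  { apply Nat.log2_unique; [lia|]. rewrite Nat.pow_succ_r'. lia. }
  pose proof (Nat.pow_le_mono_r 2 1 L ltac:(lia) HL) as H2. rewrite Nat.pow_1_r in H2.
  rewrite log2_half in Hlog by lia. simpl.
  destruct (Nat.eqb_spec ((2 ^ L + p) / 2) 0); lia.
Qed.

Lemma good_fail d st :
  stat c p = Running (Split p P d st) -> collided (stat c) g p d ->
  (st = ReadY \/ st = ReadX) ->
  good_step n L k c g [(1, after c p (Split p P d st) (settle (descend L p P d)))].
Proof.
  intros Hs Hc Hst. pose proof (inv_local _ _ _ _ HI p) as Hloc. rewrite Hs in Hloc. simpl in Hloc.
  destruct Hloc as (Hp & Hlen & _ & _ & Hd & HT).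
  assert (Hss : splitting (stat c) p d st) by (exists p, P; auto).
  assert (HM : forall x, regs (after c p (Split p P d st) x) = regs c).
  { intros x. rewrite regs_after. destruct Hst as [-> | ->]; reflexivity. }
  unfold descend. destruct (Nat.ltb_spec d L) as [HdL|HdL].
  - cbn [settle]. apply good_step_one with (g' := g); auto; try discriminate.
    + apply inv_after with (g := g); auto; try discriminate; rewrite ?HM.
      * simpl. repeat split; auto. destruct Hst as [-> | ->]; simpl in *; lia.
      * apply split_descend with st; auto. apply (inv_split _ _ _ _ HI).
      * apply (stat_nonclimb_frame n L c g p _ _ _ HI Hs); auto; try discriminate.
        intros (_ & _ & H). exfalso. eapply H; eauto.
    + left. unfold candidate. rewrite Hs. exact I.
    + apply Req_le. apply pot_split_step with (s := Split p P d st); eauto 10.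
  - set (m := up (Backup (2 ^ L + p))). unfold start_climb. cbn [settle].
    assert (HI' : inv n L (after c p (Split p P d st) (Running (Climb (fst m) (snd m) Start))) g).
    { apply inv_after with (g := g); auto; try discriminate; rewrite ?HM.
      - simpl. auto.
      - apply split_leave with (M := regs c) (g := g); try discriminate; auto.
        apply (inv_split _ _ _ _ HI).
      - apply duel_enter with (g := g) (d := d) (s0 := st); auto.
        + apply (inv_duel _ _ _ _ HI).
        + apply leaf_ok; lia.
        (* The leaf slot is fresh: otherwise [p] would have left the splitters already. *)
        + intros Ht. apply (touched_justified _ _ _ _ (inv_duel _ _ _ _ HI)) in Ht.
          apply justified_leaf in Ht. destruct Ht as (_ & _ & Ht). eapply Ht; eauto.
        + apply justified_leaf.
          destruct (entered_climb (fst m) (snd m) Start) as (H1 & H2 & H3).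
          unfold entered, at_door, splitting in *. rewrite upd_eq. auto. }
    apply good_step_one with (g' := g); auto; try discriminate.
    + left. unfold candidate. rewrite Hs. exact I.
    + apply pot_enter_le with (d := d) (d0 := S L) (st := st); [exact Hs|exact HI'|lia| |].
      * pose proof (height_leaf Hp). fold m in H. lia.
      * right. exists L. replace L with d by lia. auto.
Qed.

Lemma good_stop d :
  stat c p = Running (Split p P d ReadX) -> regs c (RX (prefix_node g p d)) = S p ->
  good_step n L k c g
    [(1, after c p (Split p P d ReadX) (settle (Climb (Outer (prefix_node g p d)) false Start)))].
Proof.
  intros Hs Hv. pose proof (inv_local _ _ _ _ HI p) as Hloc. rewrite Hs in Hloc. simpl in Hloc.
  destruct Hloc as (Hp & Hlen & _ & _ & Hd & HT). cbn [settle].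
  set (v := prefix_node g p d) in *.
  assert (Hss : splitting (stat c) p d ReadX) by (exists p, P; auto).
  set (g' := mark_stopped g v).
  assert (Hst : forall w, stopped g' w = true <-> w = v \/ stopped g w = true).
  { intros w. simpl. destruct (Nat.eqb_spec w v); intuition. }
  assert (HI' : inv n L (after c p (Split p P d ReadX) (Running (Climb (Outer v) false Start))) g').
  { apply inv_after with (g := g); auto; try discriminate; rewrite ?regs_after; cbn [pact].
    - simpl. auto.
    - apply split_stop with (g := g) (d := d); auto. apply (inv_split _ _ _ _ HI).
    - apply duel_enter with (g := g) (d := d) (s0 := ReadX); auto.
      + apply (inv_duel _ _ _ _ HI).
      + intros w Hw. apply Hst. auto.
      + simpl. apply node_firstn_lt. auto.
      (* The slot is fresh: had the node stopped somebody before, X could not name [p]. *)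
      + intros Ht. apply (touched_justified _ _ _ _ (inv_duel _ _ _ _ HI)) in Ht.
        simpl in Ht. eapply (stopped_X _ _ _ _ (inv_split _ _ _ _ HI) v p d ReadX); auto.
      + simpl. rewrite Nat.eqb_refl. reflexivity. }
  apply good_step_one with (g' := g'); auto; try discriminate.
  - left. unfold candidate. rewrite Hs. exact I.
  - apply pot_enter_le with (d := d) (d0 := d) (st := ReadX); [exact Hs|exact HI'|lia| |].
    + simpl. unfold v, prefix_node. rewrite log2_node, length_firstn. lia.
    + destruct d as [|d']; [auto|]. right. exists d'. split; auto.
      eapply (split_collided _ _ _ _ (inv_split _ _ _ _ HI)); eauto.
Qed.

Lemma good_close :
  stat c p = Running CloseDoor ->
  good_step n L k c g [(1, after c p CloseDoor (settle (Exit true)))].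
Proof.
  intros Hs. pose proof (inv_local _ _ _ _ HI p) as Hloc. rewrite Hs in Hloc. simpl in Hloc.
  destruct Hloc as (Hp & Hlen & Hlost). cbn [settle].
  apply good_step_one with (g' := g); auto; try discriminate.
  - apply inv_after with (g := g); auto; try discriminate; rewrite ?regs_after; cbn [pact].
    + simpl. auto.
    + apply split_leave with (M := regs c) (g := g); try discriminate; auto.
      apply (inv_split _ _ _ _ HI).
    + apply (stat_nonclimb_frame n L c g p _ _ _ HI Hs); auto; try discriminate.
      intros _. split; [discriminate|split].
      * intros (? & ? & ?). discriminate.
      * intros ? ? (? & ? & ?). discriminate.
  - intros [].
  - unfold pot. rewrite !upd_eq, Hs. lra.
Qed.

(** Climbing lowers the height, which frees a factor 1.2 for the next duel. A loser has only the
    door left to close, and the spare factor 1.01 in [pot] pays for this step. *)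
Lemma pot_after_duel g' o s a a' :
  stat c p = Running (Climb o s a) ->
  inv n L (after c p (Climb o s a) (settle (after_duel o s a'))) g' ->
  duel_of g' o s = a' ->
  pot n (upd (stat c) p (settle (after_duel o s a'))) (upd (steps c) p (S (steps c p))) g' p
  <= 1.01 ^ (S (S (steps c p))) * 1.2 ^ height o * duel_potR a' (duel_of g' o (negb s)).
Proof.
  intros Hs HI' Ha'. pose proof (inv_duel _ _ _ _ HI') as HD.
  pose proof (compat_slots _ _ _ _ o s HD) as Hc. rewrite Ha' in Hc. apply duel_potR_bounds in Hc.
  set (V := duel_potR a' (duel_of g' o (negb s))) in *.
  assert (Hy : 1 <= 1.01 ^ S (steps c p)) by (apply pow_R1_Rle; lra).
  assert (HK : 1 <= 1.2 ^ height o) by (apply pow_R1_Rle; lra).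
  unfold pot. rewrite !upd_eq. change (1.01 ^ S (S (steps c p))) with (1.01 * 1.01 ^ S (steps c p)).
  set (y := 1.01 ^ S (steps c p)) in *. set (K := 1.2 ^ height o) in *.
  assert (H1 : 1.01 * y <= 1.01 * y * K * V).
  { assert (1 <= K * V) by nra. nra. }
  destruct a'; simpl; try (unfold V, K; lra).
  - destruct (obj_eq_dec o (Backup 0)) as [Ho|Ho]; simpl; [fold y; lra|].
    fold y.
    assert (Hm : duel_of g' (fst (up o)) (snd (up o)) = Start).
    { eapply (climb_ok _ _ _ _ HD p). unfold after. simpl. rewrite upd_eq. simpl.
      destruct (obj_eq_dec o (Backup 0)); [contradiction|reflexivity]. }
    pose proof (compat_slots _ _ _ _ (fst (up o)) (snd (up o)) HD) as Hc'. rewrite Hm in Hc'.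
    apply duel_potR_bounds in Hc'.
    set (V' := duel_potR Start _) in *.
    assert (HK' : 1.2 ^ height (fst (up o)) * 1.2 <= K).
    { unfold K. rewrite Rmult_comm. change (1.2 * 1.2 ^ height (fst (up o)))
        with (1.2 ^ S (height (fst (up o)))). apply pow_1_2_le. apply height_up. auto. }
    assert (H0 : 0 < 1.2 ^ height (fst (up o))) by (apply pow_lt; lra).
    set (K' := 1.2 ^ height (fst (up o))) in *.
    assert (K' * V' <= K * V) by nra.
    rewrite !Rmult_assoc. nra.
  - fold y. lra.
Qed.

Lemma inv_after_duel o s a a' :
  stat c p = Running (Climb o s a) ->
  compat a' (duel_of g o (negb s)) -> a' <> Start ->
  duel_reg a' = match duel_write a with Some w => w | None => duel_reg a end ->
  inv n L (after c p (Climb o s a) (settle (after_duel o s a'))) (with_duel g o s a').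
Proof.
  intros Hs Hc Ha' Hreg. pose proof (inv_local _ _ _ _ HI p) as Hloc. rewrite Hs in Hloc.
  destruct Hloc as (Hp & Hlen & _).
  pose proof (inv_duel _ _ _ _ HI) as HD.
  destruct (climb_ok _ _ _ _ HD _ _ _ _ Hs) as (Hok & Hu & Ha).
  set (x := settle (after_duel o s a')).
  assert (Hx : match x with
               | Running (Climb _ _ _) | Done false => True
               | Running CloseDoor => a' = Lost
               | _ => False
               end).
  { unfold x. destruct a'; simpl; try destruct (obj_eq_dec _ _); simpl; auto. }
  apply inv_after with (g := g); auto; try discriminate.
  - intros o' s' H. simpl. rewrite upd_duel_neq; auto. intros E. injection E as -> ->.
    rewrite <- Ha, H in Hu. discriminate.
  - unfold local_at. destruct x as [|[| | | |]|]; try contradiction; simpl; auto.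
    subst a'. repeat split; auto. exists o, s. apply upd_duel_eq.
  - intros E. rewrite E in Hx. contradiction.
  - apply split_leave with (M := regs c) (g := g); try reflexivity.
    + apply (inv_split _ _ _ _ HI).
    + intros v. rewrite regs_after. simpl. destruct (duel_write a); reflexivity.
    + intros v. rewrite regs_after. simpl. destruct (duel_write a); reflexivity.
    + intros E. rewrite E in Hx. contradiction.
    + intros i Q d st E. rewrite E in Hx. contradiction.
    + intros i Q E. rewrite E in Hx. contradiction.
  - apply duel_move with (M := regs c) (a := a); auto.
    intros o' s'. rewrite regs_after. cbn [pact].
    assert (Hslot : (o', s') = (o, s) \/ (o', s') <> (o, s)) by apply classic.
    destruct Hslot as [E|E].
    + injection E as -> ->. rewrite upd_duel_eq, Hreg. destruct (duel_write a); simpl.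
      * unfold upd_reg. destruct (reg_eq_dec _ _); congruence.
      * rewrite (duel_mem _ _ _ _ HD). congruence.
    + rewrite upd_duel_neq, <- (duel_mem _ _ _ _ HD) by auto.
      destruct (duel_write a); simpl; auto.
      unfold upd_reg. destruct (reg_eq_dec _ _); congruence.
Qed.

Lemma settle_not_idle s : settle s <> Idle.
Proof. destruct s; discriminate. Qed.

(** Only [p] and the player in the opposite slot change their potentials; the two inequalities of
    [duel_pot_step], scaled by nonnegative factors, handle one each. *)
Lemma good_duel o s a :
  stat c p = Running (Climb o s a) ->
  good_step n L k c g
    (map (fun ws => (fst ws, after c p (Climb o s a) (settle (snd ws))))
       (pnext L (Climb o s a) (response c (Climb o s a)))).
Proof.
  intros Hs. pose proof (inv_duel _ _ _ _ HI) as HD.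
  destruct (climb_ok _ _ _ _ HD _ _ _ _ Hs) as (Hok & Hu & Ha).
  pose proof (compat_slots _ _ _ _ o s HD) as Hc. rewrite Ha in Hc.
  set (b := duel_of g o (negb s)) in *.
  assert (Hnext : duel_next a (response c (Climb o s a)) = duel_next a (duel_reg b)).
  { unfold response. cbn [pact]. destruct (duel_write a) as [w|] eqn:E.
    - destruct (duel_write_next a (duel_reg b) w E) as [-> _]. reflexivity.
    - cbn [pact]. rewrite (duel_mem _ _ _ _ HD). reflexivity. }
  cbn [pnext]. rewrite Hnext.
  pose proof (duel_pot_step a b Hc Hu) as Hpot.
  pose proof (compat_next a b Hc Hu) as Hcn.
  pose proof (duel_next_not_Start a (duel_reg b)) as Hns.
  assert (Hreg : duel_reg (fst (duel_next a (duel_reg b))) =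
                   match duel_write a with Some w => w | None => duel_reg a end /\
                 duel_reg (snd (duel_next a (duel_reg b))) =
                   match duel_write a with Some w => w | None => duel_reg a end).
  { destruct (duel_write a) as [w|] eqn:E.
    - apply (duel_write_next a (duel_reg b) w E).
    - apply (duel_read_next a (duel_reg b) E). }
  destruct (duel_next a (duel_reg b)) as [a1 a2]. simpl in Hcn, Hns, Hreg.
  set (x1 := settle (after_duel o s a1)). set (x2 := settle (after_duel o s a2)).
  assert (HI1 : inv n L (after c p (Climb o s a) x1) (with_duel g o s a1))
    by (apply inv_after_duel; tauto).
  assert (HI2 : inv n L (after c p (Climb o s a) x2) (with_duel g o s a2))
    by (apply inv_after_duel; tauto).
  assert (Hsi : stat c p <> Idle) by congruence.
  assert (Hxi : forall a', settle (after_duel o s a') <> Idle) by (intros; apply settle_not_idle).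
  assert (Hother : forall a' r, r <> p ->
    pot n (upd (stat c) p (settle (after_duel o s a'))) (upd (steps c) p (S (steps c p)))
        (with_duel g o s a') r =
    match stat c r with
    | Running (Climb o' s' b') =>
        if obj_eq_dec o' o then if bool_dec (negb s') s
        then 1.01 ^ S (steps c r) * 1.2 ^ height o * duel_potR b a'
        else pot n (stat c) (steps c) g r else pot n (stat c) (steps c) g r
    | _ => pot n (stat c) (steps c) g r
    end).
  { intros a' r Hr. destruct (stat c r) as [|[| |o' s' b'| |]|] eqn:E;
      try (apply pot_other; auto; rewrite E; congruence).
    destruct (obj_eq_dec o' o) as [->|Ho].
    - destruct (bool_dec (negb s') s) as [Hs'|Hs'].
      + unfold pot. rewrite !upd_neq, E by auto. simpl. rewrite Hs', upd_duel_eq.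
        destruct (climb_ok _ _ _ _ HD _ _ _ _ E) as (_ & _ & <-).
        unfold b. rewrite <- Hs', negb_involutive. reflexivity.
      + apply pot_other; auto. intros o'' s'' a'' E'. rewrite E in E'. injection E' as <- <- <-.
        simpl. apply upd_duel_neq. congruence.
    - apply pot_other; auto. intros o'' s'' a'' E'. rewrite E in E'. injection E' as <- <- <-.
      simpl. apply upd_duel_neq. congruence. }
  exists [(1/2, (after c p (Climb o s a) x1, with_duel g o s a1));
          (1/2, (after c p (Climb o s a) x2, with_duel g o s a2))].
  split; [reflexivity|]. split; [|split; [simpl; lra|]].
  - assert (Hcand : candidate (stat c) p) by (unfold candidate; rewrite Hs; exact I).
    assert (Hni : forall x, x <> Idle -> (ninvoked pstate n (after c p (Climb o s a) x) <= k)%nat).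
    { intros x Hx. rewrite (ninvoked_ext n c); auto. apply is_idle_upd; auto. }
    assert (Ht : forall a', trans c (after c p (Climb o s a) (settle (after_duel o s a'))))
      by (intros; apply trans_after; auto).
    apply Forall_cons; [|apply Forall_cons; [|apply Forall_nil]];
      (split; [simpl; lra|]; split; [assumption|]; split; [apply Ht | apply Hni, Hxi]).
  - unfold Ex. simpl. unfold total_pot. rewrite !invoked_upd by (auto; apply Hxi).
    fold x1 x2.
    (* Both outcomes have weight 1/2, so their sum is compared with twice the old potential, process
       by process. *)
    assert (Hsum : Rsum n (fun r =>
        pot n (upd (stat c) p x1) (upd (steps c) p (S (steps c p))) (with_duel g o s a1) r +
        pot n (upd (stat c) p x2) (upd (steps c) p (S (steps c p))) (with_duel g o s a2) r)
      <= Rsum n (fun r => 2 * pot n (stat c) (steps c) g r)).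
    { apply Rsum_le. intros r _. destruct (Nat.eq_dec r p) as [->|Hr].
      - assert (H1 := pot_after_duel (with_duel g o s a1) o s a a1 Hs HI1 (upd_duel_eq _ _ _ _)).
        assert (H2 := pot_after_duel (with_duel g o s a2) o s a a2 Hs HI2 (upd_duel_eq _ _ _ _)).
        assert (Hb : forall a', duel_of (with_duel g o s a') o (negb s) = b).
        { intros a'. simpl. apply upd_duel_neq. destruct s; simpl; congruence. }
        rewrite Hb in H1, H2. fold x1 in H1. fold x2 in H2.
        unfold pot at 3. rewrite Hs. fold b.
        change (1.01 ^ S (S (steps c p))) with (1.01 * 1.01 ^ S (steps c p)) in H1, H2.
        assert (H0 : 0 <= 1.01 ^ S (steps c p) * 1.2 ^ height o)
          by (apply Rmult_le_pos; apply pow_le; lra).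
        set (z := 1.01 ^ S (steps c p)) in *. set (K := 1.2 ^ height o) in *.
        assert (H3 := Rmult_le_compat_l _ _ _ H0 (proj1 Hpot)). lra.
      - unfold x1, x2. rewrite !Hother by auto.
        destruct (stat c r) as [|[| |o' s' b'| |]|] eqn:E; try lra.
        destruct (obj_eq_dec o' o) as [->|Ho]; [|lra].
        destruct (bool_dec (negb s') s) as [Hs'|Hs']; [|lra].
        unfold pot. rewrite E.
        destruct (climb_ok _ _ _ _ HD _ _ _ _ E) as (_ & _ & Hb').
        assert (Hbb : b' = b) by (unfold b; rewrite <- Hs', negb_involutive; auto).
        rewrite Hbb, Hs', Ha.
        assert (H0 : 0 <= 1.01 ^ S (steps c r) * 1.2 ^ height o)
          by (apply Rmult_le_pos; apply pow_le; lra).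
        set (z := 1.01 ^ S (steps c r)) in *. set (K := 1.2 ^ height o) in *.
        assert (H3 := Rmult_le_compat_l _ _ _ H0 (proj2 Hpot)). lra. }
    rewrite Rsum_plus, Rsum_scal in Hsum. lra.
Qed.

End Cases.

Section AllSteps.
Variables n L : nat.
Hypothesis HL : (1 <= L)%nat.
Hypothesis HnL : (n <= 2 ^ L)%nat.

Notation status := (Status pstate).

Lemma invoked_ninvoked (m : nat) (c : Config pstate) : invoked m (stat c) = INR (ninvoked pstate m c).
Proof.
  unfold invoked, ninvoked. induction m as [|m IH]; [reflexivity|].
  rewrite seq_S, filter_app, length_app, plus_INR. simpl. rewrite IH.
  destruct (is_idle (stat c m)); simpl; lra.
Qed.

(** * Invocation with a random path *)

Section Invocation.
Variables (k : nat) (c : Config pstate) (g : ghost) (p : nat).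
Hypothesis HI : inv n L c g.
Hypothesis Hk : (ninvoked pstate n c < k)%nat.
Hypothesis Hp : (p < n)%nat.
Hypothesis Hs : stat c p = Idle.

Definition invoke (P : list bool) : Config pstate :=
  {| mem := mem c; stat := upd (stat c) p (Running (Door p P)); steps := steps c |}.

Definition with_path (P : list bool) : ghost :=
  {| duel_of := duel_of g; stopped := stopped g; path_of := upd (path_of g) p P |}.

Lemma nonidle_neq q : stat c q <> Idle -> q <> p.
Proof. congruence. Qed.

Lemma inv_invoke P : length P = L -> inv n L (invoke P) (with_path P).
Proof.
  intros HP. destruct HI as [I1 I2 I3 I4].
  assert (Hnode : forall q d, q <> p -> prefix_node (with_path P) q d = prefix_node g q d).
  { intros q d Hq. unfold prefix_node. simpl. rewrite upd_neq by auto. reflexivity. }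
  assert (Hsp : forall q d s, splitting (upd (stat c) p (Running (Door p P))) q d s ->
                q <> p /\ splitting (stat c) q d s).
  { intros q d s H. apply splitting_upd in H as [[-> (? & ? & H)]|H]; [discriminate|auto]. }
  assert (Hni : forall q, stat c q <> Idle -> upd (stat c) p (Running (Door p P)) q <> Idle).
  { intros q H. apply nonidle_upd; [discriminate|auto]. }
  change (regs (invoke P)) with (regs c) in *.
  split; change (regs (invoke P)) with (regs c); cbn [stat steps invoke].
  - intros q. destruct (Nat.eq_dec q p) as [->|Hq].
    + rewrite upd_eq. simpl. rewrite upd_eq. specialize (I1 p). rewrite Hs in I1. simpl in I1. auto 6.
    + rewrite upd_neq by auto. specialize (I1 q). unfold local_at in *. simpl.
      rewrite upd_neq by auto. exact I1.
  - destruct I2 as [H1 H2]. split; [exact H1|]. intros q H. apply (H2 q).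
    destruct (Nat.eq_dec q p) as [->|Hq];
      [rewrite upd_eq in H; discriminate | rewrite upd_neq in H; auto].
  - split; intros.
    + apply (stopped_Y _ _ _ _ I3). auto.
    + apply Hsp in H as [Hq H]. rewrite Hnode by auto. apply (late_Y _ _ _ _ I3). auto.
    + apply Hsp in H0 as [Hq H0]. rewrite Hnode in H2 by auto.
      eapply (stopped_X _ _ _ _ I3); eauto.
    + apply Hsp in H as [Hq H]. rewrite Hnode by auto. eapply (late_X _ _ _ _ I3); eauto.
    + apply Hsp in H as [Hq H]. eapply (split_Y _ _ _ _ I3); eauto.
    + apply at_door_upd in H as [[-> _]|[_ H]].
      (* A name in a register belongs to an invoked process, and [p] was idle. *)
      * intros E. destruct (visited _ _ _ _ I3 v p) as [H1 _]; auto.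
      * eapply (door_Y _ _ _ _ I3); eauto.
    + destruct (visited _ _ _ _ I3 v q H) as [H1 (d & H2 & H3)]. split; auto.
      exists d. rewrite Hnode by (apply nonidle_neq; auto). auto.
    + apply Hsp in H as [Hq H]. apply (split_collided _ _ _ _ I3) in H.
      destruct H as (r & H1 & H2 & H3). exists r. split; auto. split; auto.
      simpl. rewrite !upd_neq by (auto; apply nonidle_neq; auto). auto.
  - apply duel_frame with (M := regs c) (g := g); auto; try congruence.
    intros (H & _). congruence.
Qed.

Lemma trans_invoke P : trans c (invoke P).
Proof.
  split; [auto|]. intros q. unfold invoke, candidate. simpl.
  destruct (Nat.eq_dec q p) as [->|Hq].
  - rewrite upd_eq, Hs. repeat split; auto; discriminate.
  - rewrite upd_neq by auto. auto.
Qed.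

Lemma invoked_invoke P : invoked n (stat (invoke P)) = invoked n (stat c) + 1.
Proof.
  unfold invoked. simpl.
  rewrite (Rsum_ext _ _ (fun q => (if is_idle (stat c q) then 0 else 1) +
                                  (if Nat.eqb q p then 1 else 0))).
  - rewrite Rsum_plus, Rsum_indicator by auto. reflexivity.
  - intros q _. destruct (Nat.eqb_spec q p) as [->|Hq].
    + rewrite upd_eq, Hs. simpl. lra.
    + rewrite upd_neq by auto. lra.
Qed.

Definition weight (P : list bool) (q : nat) : R :=
  if is_idle (stat c q) then 0 else overlap P (path_of g q).

Lemma pot_invoke_self P :
  pot n (stat (invoke P)) (steps c) (with_path P) p = 3 + 3 * Rsum n (weight P).
Proof.
  unfold pot. simpl. rewrite upd_eq. unfold descent_pot.
  rewrite (Rsum_ext _ _ (weight P)); [lra|].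
  intros q _. unfold pair_pot, weight. simpl. destruct (Nat.eqb_spec q p) as [->|Hq].
  - rewrite Hs. reflexivity.
  - rewrite upd_eq, !upd_neq by auto. reflexivity.
Qed.

Lemma pot_invoke_other P r :
  r <> p -> pot n (stat (invoke P)) (steps c) (with_path P) r
            <= pot n (stat c) (steps c) g r + 3 * weight P r.
Proof.
  intros Hr. unfold pot. simpl. rewrite upd_neq by auto. unfold weight.
  pose proof (overlap_ge_1 P (path_of g r)).
  assert (Hd : descent_pot n (upd (stat c) p (Running (Door p P))) (with_path P) r =
               descent_pot n (stat c) g r + 3 * overlap P (path_of g r)).
  { unfold descent_pot.
    rewrite (Rsum_ext _ _ (fun q => pair_pot (stat c) g r q +
                              (if Nat.eqb q p then overlap P (path_of g r) else 0))).
    - rewrite Rsum_plus, Rsum_indicator by auto. lra.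
    - intros q _. unfold pair_pot. simpl. destruct (Nat.eqb_spec q p) as [->|Hq].
      + rewrite !upd_eq, upd_neq, Hs by auto. simpl.
        destruct (Nat.eqb_spec p r); [congruence|]. rewrite overlap_sym. lra.
      + rewrite !upd_neq by auto. lra. }
  destruct (stat c r) as [|[]|]; simpl; rewrite ?Hd; lra.
Qed.

(** Each overlap of the new path with an older one is charged at most twice, to the newcomer and to
    the older process, hence the coefficient [6 = 3 + 3]; its mean is at most 2 by [Ex_overlap]. *)
Lemma good_invoke :
  good_step n L k c g (map (fun x => (fst x, invoke (snd x))) (random_path L)).
Proof.
  destruct (random_path_ok L) as [Hnn Hsum].
  exists (map (fun x => (fst x, (invoke (snd x), with_path (snd x)))) (random_path L)).
  split; [rewrite map_map; reflexivity|]. split; [|split].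
  - apply Forall_map. apply Forall_forall. intros x Hx. simpl.
    rewrite Forall_forall in Hnn. split; [apply Hnn; auto|].
    split; [apply inv_invoke; eapply random_path_length; eauto|].
    split; [apply trans_invoke|].
    apply INR_le. rewrite <- invoked_ninvoked, invoked_invoke, invoked_ninvoked.
    rewrite <- S_INR. apply le_INR. lia.
  - rewrite map_map. simpl. exact Hsum.
  - set (J := invoked n (stat c)).
    set (base := Rsum n (pot n (stat c) (steps c) g)).
    rewrite Ex_map with (h := fun P => (invoke P, with_path P)). cbn [fst snd].
    apply Rle_trans with
      (Ex (random_path L) (fun P => (base + 3 + 6 * (INR k ^ 2 - (J + 1) ^ 2)) +
                                    6 * Rsum n (weight P))).
    + apply Ex_le. eapply Forall_impl; [|exact Hnn]. intros x Hx. split; [exact Hx|].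
      unfold total_pot. rewrite invoked_invoke. fold J. cbn [steps invoke].
      assert (H : Rsum n (pot n (stat (invoke (snd x))) (steps c) (with_path (snd x))) <=
                  Rsum n (fun r => pot n (stat c) (steps c) g r +
                           (3 * weight (snd x) r +
                            (if Nat.eqb r p then 3 + 3 * Rsum n (weight (snd x)) else 0)))).
      { apply Rsum_le. intros r _. destruct (Nat.eqb_spec r p) as [->|Hr].
        - rewrite pot_invoke_self. unfold pot, weight at 2. rewrite Hs. simpl. lra.
        - pose proof (pot_invoke_other (snd x) r Hr). lra. }
      rewrite !Rsum_plus, Rsum_scal, Rsum_indicator in H by auto. fold base in H. simpl in *. lra.
    + rewrite Ex_plus, Ex_const, Ex_scal, Ex_Rsum by exact Hsum.
      assert (H : Rsum n (fun q => Ex (random_path L) (fun P => weight P q)) <=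
                  Rsum n (fun q => 2 * (if is_idle (stat c q) then 0 else 1))).
      { apply Rsum_le. intros q _. unfold weight. destruct (is_idle (stat c q)).
        - rewrite Ex_const by exact Hsum. lra.
        - pose proof (Ex_overlap L (path_of g q)). lra. }
      rewrite Rsum_scal in H. fold (invoked n (stat c)) in H. fold J in H.
      unfold total_pot. fold J base. nra.
Qed.

End Invocation.

Lemma good_step_all k c g ch :
  inv n L c g -> (ninvoked pstate n c <= k)%nat -> good_step n L k c g (step (ratrace L) n k c ch).
Proof.
  intros HI Hk. destruct ch as [p b].
  destruct (Nat.ltb_spec p n) as [Hp|Hp].
  2:{ unfold step. apply Nat.ltb_ge in Hp. rewrite Hp. apply good_step_refl; auto. }
  destruct (stat c p) as [|s|b'] eqn:Hs.
  - unfold step. change (st (ratrace L)) with pstate. apply Nat.ltb_lt in Hp as Hp'. rewrite Hp', Hs.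
    destruct (b && Nat.ltb (ninvoked pstate n c) k) eqn:E; [|apply good_step_refl; auto].
    apply andb_true_iff in E as [_ E]. apply Nat.ltb_lt in E.
    cbn [start ratrace]. rewrite map_map. cbn [fst snd].
    rewrite (map_ext _ (fun x => (fst x, invoke c p (snd x)))).
    + apply good_invoke; auto.
    + intros x. rewrite mk_status_settle by exact I. reflexivity.
  - pose proof (inv_local _ _ _ _ HI p) as Hloc. rewrite Hs in Hloc. simpl in Hloc.
    destruct Hloc as (_ & _ & Hloc).
    assert (Hok : state_ok L s).
    { destruct s; simpl in *; try tauto.
      eapply (climb_ok _ _ _ _ (inv_duel _ _ _ _ HI)); eauto. }
    rewrite (step_running n L k c p b s) by (auto; intros b' ->; contradiction).
    destruct s as [i P|i P d st|o s a| |b']; [| | | |contradiction].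
    + destruct Hloc as (-> & -> & _). cbn [pnext map fst snd response pact].
      rewrite mk_status_settle by (destruct (Nat.eqb _ _); simpl; [lia|exact I]).
      apply good_door; auto.
    + destruct Hloc as (-> & -> & Hd & _).
      assert (Hlen : forall q, stat c q <> Idle -> length (path_of g q) = L)
        by (apply inv_length with n; auto).
      destruct st; cbn [pnext map fst snd response pact].
      * rewrite mk_status_settle by exact Hd. apply good_internal with (v := 0%nat); auto. discriminate.
      * fold (prefix_node g p d). destruct (Nat.eqb_spec (regs c (RY (prefix_node g p d))) 0) as [Hv|Hv].
        -- rewrite mk_status_settle by exact Hd. apply good_internal with (v := 0%nat); auto.
        -- rewrite mk_status_settle by (apply descend_ok; lia). apply good_fail; auto.
           eapply split_fail_Y; eauto. apply (inv_split _ _ _ _ HI).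
      * rewrite mk_status_settle by exact Hd. apply good_internal with (v := 0%nat); auto. discriminate.
      * fold (prefix_node g p d).
        destruct (Nat.eqb_spec (regs c (RX (prefix_node g p d))) (S p)) as [Hv|Hv].
        -- rewrite mk_status_settle by (apply node_firstn_lt; auto). apply good_stop; auto.
        -- rewrite mk_status_settle by (apply descend_ok; lia). apply good_fail; auto.
           eapply split_fail_X; eauto. apply (inv_split _ _ _ _ HI).
    + rewrite (map_ext_in _ (fun ws => (fst ws, after c p (Climb o s a) (settle (snd ws))))).
      * apply good_duel; auto.
      * intros ws Hws. rewrite mk_status_settle; [reflexivity|].
        assert (Hall : forall a', state_ok L (after_duel o s a')).
        { intros a'. destruct a'; simpl; auto. destruct (obj_eq_dec o (Backup 0)); simpl; auto.
          apply up_ok; auto. }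
        cbn [pnext] in Hws. destruct (duel_next a _) as [a1 a2].
        destruct Hws as [<-|[<-|[]]]; apply Hall.
    + cbn [pnext map fst snd]. rewrite mk_status_settle by exact I. apply good_close; auto.
  - unfold step. apply Nat.ltb_lt in Hp as Hp'. rewrite Hp'.
    change (st (ratrace L)) with pstate. rewrite Hs. apply good_step_refl; auto.
Qed.

(** * Expected and likely step complexity *)

(** The supermartingale argument: by induction on [t], an affine bound at the end of the run carries
    over to its start, whatever the adversary chooses. *)
Lemma expect_le k (A : Adversary (ratrace L)) f a b :
  0 <= b ->
  (forall c h g, inv n L c g -> (ninvoked pstate n c <= k)%nat ->
     f (c :: h) <= a + b * total_pot n k (stat c) (steps c) g) ->
  forall t c h g, inv n L c g -> (ninvoked pstate n c <= k)%nat ->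
  expect (ratrace L) n k A t f (c :: h) <= a + b * total_pot n k (stat c) (steps c) g.
Proof.
  intros Hb Hf t. induction t as [|t IH]; intros c h g HI Hk; [apply Hf; auto|].
  simpl. change (st (ratrace L)) with pstate in *.
  destruct (good_step_all k c g (A (c :: h)) HI Hk) as (l & Hl & Hall & Hsum & Hpot).
  change (st (ratrace L)) with pstate in *.
  rewrite Hl, map_map. cbn [fst snd].
  change (Ex l (fun cg => expect (ratrace L) n k A t f (fst cg :: c :: h))
          <= a + b * total_pot n k (stat c) (steps c) g).
  apply Rle_trans with
    (Ex l (fun cg => a + b * total_pot n k (stat (fst cg)) (steps (fst cg)) (snd cg))).
  - apply Ex_le. eapply Forall_impl; [|exact Hall]. intros [w [c' g']]. simpl.
    intros (Hw & HI' & _ & Hk'). split; [exact Hw|]. apply IH; auto.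
  - rewrite Ex_plus, Ex_const, Ex_scal by exact Hsum. nra.
Qed.

(** Turns upper bounds on expectations into the lower bound needed for a probability. *)
Lemma expect_opp k (A : Adversary (ratrace L)) f t h :
  expect (ratrace L) n k A t (fun h => - f h) h = - expect (ratrace L) n k A t f h.
Proof.
  revert h. induction t as [|t IH]; intros h; simpl; [reflexivity|].
  destruct h as [|c h]; [reflexivity|].
  change (Ex (step (ratrace L) n k c (A (c :: h)))
            (fun c' => expect (ratrace L) n k A t (fun h => - f h) (c' :: c :: h)) =
          - Ex (step (ratrace L) n k c (A (c :: h)))
            (fun c' => expect (ratrace L) n k A t f (c' :: c :: h))).
  generalize (step (ratrace L) n k c (A (c :: h))). intros d.
  unfold Ex. induction d as [|x d IHd]; cbn [map fold_right]; [lra|].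
  rewrite IHd, IH. lra.
Qed.

(** The summand 1 is for idle processes, with potential 0 and no steps; in all other cases the
    potential alone suffices. *)
Lemma steps_pot c g p : inv n L c g -> 1.01 ^ steps c p <= 1 + pot n (stat c) (steps c) g p.
Proof.
  intros HI. pose proof (inv_local _ _ _ _ HI p) as Hloc. unfold local_at in Hloc.
  assert (Hy : forall t, 1 <= 1.01 ^ t) by (intros; apply pow_R1_Rle; lra).
  unfold pot. destruct (stat c p) as [|[i P|i P d st|o s a| |b]|b] eqn:Hs.
  - rewrite Hloc. simpl. lra.
  - destruct Hloc as (_ & _ & _ & _ & ->). pose proof (descent_pot_ge n (stat c) g p). simpl. lra.
  - destruct Hloc as (_ & _ & _ & _ & Hd & HT).
    assert (H : 1.01 ^ steps c p * 1.2 ^ 0 * 1.2 <= descent_pot n (stat c) g p).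
    { apply descent_cost with (L := L) (T := steps c) (d := d); try lia.
      - apply (inv_local _ _ _ _ HI).
      - congruence.
      - destruct d as [|d]; [auto|]. right. exists d. split; auto.
        eapply (split_collided _ _ _ _ (inv_split _ _ _ _ HI)). exists i, P. eauto.
      - destruct st; simpl in HT; lia. }
    specialize (Hy (steps c p)). simpl in H. lra.
  - destruct (climb_ok _ _ _ _ (inv_duel _ _ _ _ HI) _ _ _ _ Hs) as (_ & _ & Ha).
    pose proof (compat_slots _ _ _ _ o s (inv_duel _ _ _ _ HI)) as Hc. rewrite Ha in Hc.
    apply duel_potR_bounds in Hc. set (V := duel_potR a _) in *.
    assert (HK : 1 <= 1.2 ^ height o) by (apply pow_R1_Rle; lra).
    specialize (Hy (steps c p)). simpl. set (K := 1.2 ^ height o) in *.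
    set (y := 1.01 ^ steps c p) in *.
    assert (1 <= K * V) by nra. rewrite Rmult_assoc. nra.
  - specialize (Hy (steps c p)). simpl. lra.
  - destruct Hloc as (_ & _ & []).
  - lra.
Qed.

Lemma pot_nonneg c g p : inv n L c g -> 0 <= pot n (stat c) (steps c) g p.
Proof.
  intros HI. pose proof (steps_pot c g p HI).
  assert (1 <= 1.01 ^ steps c p) by (apply pow_R1_Rle; lra). lra.
Qed.

Lemma maxsteps_attained (m : nat) (c : Config pstate) :
  maxsteps pstate m c = 0%nat \/ exists p, (p < m)%nat /\ maxsteps pstate m c = steps c p.
Proof.
  unfold maxsteps.
  assert (H : forall l, fold_right Nat.max 0%nat (map (steps c) l) = 0%nat \/
            exists p, In p l /\ fold_right Nat.max 0%nat (map (steps c) l) = steps c p).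
  { induction l as [|q l IH]; simpl; [auto|]. right.
    destruct (Nat.max_spec (steps c q) (fold_right Nat.max 0%nat (map (steps c) l)))
      as [[H1 ->]|[H1 ->]]; [|eauto].
    destruct IH as [IH|(p & Hp & IH)]; [lia|eauto]. }
  destruct (H (seq 0 m)) as [|(p & Hp & ->)]; auto. apply in_seq in Hp. right. exists p. split; [lia|auto].
Qed.

Lemma maxsteps_pot k c g :
  inv n L c g -> (ninvoked pstate n c <= k)%nat ->
  1.01 ^ maxsteps pstate n c <= 1 + total_pot n k (stat c) (steps c) g.
Proof.
  intros HI Hk. unfold total_pot. rewrite invoked_ninvoked. apply le_INR in Hk.
  pose proof (pos_INR (ninvoked pstate n c)).
  assert (H0 : 0 <= INR k ^ 2 - INR (ninvoked pstate n c) ^ 2) by nra.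
  pose proof (Rsum_nonneg n _ (fun p _ => pot_nonneg c g p HI)) as H1.
  destruct (maxsteps_attained n c) as [->|(p & Hp & ->)]; [simpl in *; lra|].
  pose proof (steps_pot c g p HI).
  pose proof (Rsum_term n _ p Hp (fun p _ => pot_nonneg c g p HI)). lra.
Qed.

Definition init_ghost : ghost :=
  {| duel_of := fun _ _ => Start; stopped := fun _ => false; path_of := fun _ => [] |}.

Lemma inv_init : inv n L (init_config (ratrace L)) init_ghost.
Proof.
  split.
  - intros p. simpl. auto.
  - split; simpl; [unfold regs; simpl; congruence | discriminate].
  - split; unfold splitting, at_door; simpl; intros;
      repeat match goal with H : exists _, _ |- _ => destruct H end; try discriminate.
    unfold regs in *. simpl in *. destruct H; discriminate.
  - split; unfold climbing, touched; simpl; intros;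
      repeat match goal with H : exists _, _ |- _ => destruct H end;
      try discriminate; try congruence; try reflexivity.
    destruct H as [H|(q & a & H)]; [congruence|discriminate].
Qed.

Lemma init_pot k : total_pot n k (stat (init_config (ratrace L))) (steps (init_config (ratrace L))) init_ghost
  = 6 * INR k ^ 2.
Proof.
  unfold total_pot, pot, invoked. simpl. rewrite Rsum_0. lra.
Qed.

Lemma init_ninvoked : ninvoked pstate n (init_config (ratrace L)) = 0%nat.
Proof. unfold ninvoked. simpl. induction (seq 0 n); simpl; auto. Qed.

Lemma expect_init_le k A t f a b :
  0 <= b ->
  (forall c h, f (c :: h) <= a + b * 1.01 ^ maxsteps pstate n c) ->
  expect (ratrace L) n k A t f [init_config (ratrace L)] <= a + b * (1 + 6 * INR k ^ 2).
Proof.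
  intros Hb Hf.
  assert (H : expect (ratrace L) n k A t f [init_config (ratrace L)] <=
    (a + b) + b * total_pot n k (stat (init_config (ratrace L))) (steps (init_config (ratrace L))) init_ghost).
  { apply expect_le; auto.
    - intros c h g HI Hk. pose proof (maxsteps_pot k c g HI Hk). specialize (Hf c h). nra.
    - apply inv_init.
    - rewrite init_ninvoked. lia. }
  rewrite init_pot in H. lra.
Qed.

End AllSteps.

(** * Linearizability *)

Section Linearizability.
Variables n L : nat.
Hypothesis HL : (1 <= L)%nat.
Hypothesis HnL : (n <= 2 ^ L)%nat.

Definition before (l : list nat) (a b : nat) : Prop :=
  exists l1 l2 l3, l = l1 ++ a :: l2 ++ b :: l3.

(** [dl] lists the completed operations in the order of their completion. *)
Record history_inv (c : Config pstate) (h : list (Config pstate)) (g : ghost) (dl : list nat) : Prop := {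
  hist_inv : inv n L c g;
  hist_NoDup : NoDup dl;
  hist_done : forall p, In p dl <-> is_done (stat c p) = true;
  hist_before : forall c1 a b, In c1 (c :: h) ->
    is_done (stat c1 a) = true -> is_idle (stat c1 b) = true -> In b dl -> before dl a b;
  hist_candidate : forall c1 a b, In c1 (c :: h) ->
    stat c1 a = Done true -> is_idle (stat c1 b) = true -> ~ candidate (stat c) b;
  hist_persist : forall c1 a r, In c1 (c :: h) -> stat c1 a = Done r -> stat c a = Done r
}.

Lemma is_done_Done (x : Status pstate) : is_done x = true <-> exists r, x = Done r.
Proof.
  destruct x; simpl; split; intros H; try discriminate; try (destruct H; discriminate); eauto.
Qed.

Lemma is_idle_Idle (x : Status pstate) : is_idle x = true <-> x = Idle.
Proof. destruct x; simpl; split; congruence. Qed.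

Lemma history_step c h g dl c' g' :
  history_inv c h g dl -> inv n L c' g' -> trans c c' ->
  exists dl', history_inv c' (c :: h) g' dl'.
Proof.
  intros [H1 H2 H3 H4 H5 H6] HI' [Hdoor Htr].
  (* The order within [new] is irrelevant: an operation that ended before another began was already
     in [dl] by the time the latter completes. *)
  set (new := filter (fun p => is_done (stat c' p) && negb (is_done (stat c p))) (seq 0 n)).
  assert (Hnew : forall p, In p new <-> is_done (stat c' p) = true /\ is_done (stat c p) = false).
  { intros p. unfold new. rewrite filter_In, in_seq, andb_true_iff, negb_true_iff.
    split; [tauto|]. intros [A B]. split; auto. apply is_done_Done in A as [r A].
    pose proof (inv_local _ _ _ _ HI' p) as Hloc. rewrite A in Hloc. simpl in Hloc. lia. }
  assert (Hmono : forall p, is_done (stat c p) = true -> is_done (stat c' p) = true).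
  { intros p Hp. apply is_done_Done in Hp as [r Hp]. apply Htr in Hp. rewrite Hp. reflexivity. }
  exists (dl ++ new). split.
  - exact HI'.
  - apply NoDup_app; auto.
    + apply NoDup_filter, seq_NoDup.
    + intros p Hp Hp'. apply H3 in Hp. apply Hnew in Hp'. destruct Hp'. congruence.
  - intros p. rewrite in_app_iff, H3, Hnew. destruct (is_done (stat c p)) eqn:E.
    + split; auto.
    + intuition congruence.
  - intros c1 a b Hc1 Ha Hb Hin. apply in_app_iff in Hin. destruct Hc1 as [<-|Hc1].
    + assert (is_done (stat c' b) = true) by (destruct Hin as [Hin|Hin];
        [apply Hmono, H3, Hin | apply Hnew in Hin; tauto]).
      destruct (stat c' b); discriminate.
    + destruct Hin as [Hin|Hin].
      * destruct (H4 c1 a b Hc1 Ha Hb Hin) as (l1 & l2 & l3 & ->).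
        exists l1, l2, (l3 ++ new). repeat (rewrite <- app_assoc; simpl). reflexivity.
      * assert (Had : In a dl).
        { apply is_done_Done in Ha as [r Ha]. apply H3. apply is_done_Done. eauto. }
        apply in_split in Had as (l1 & l2 & ->). apply in_split in Hin as (m1 & m2 & ->).
        exists l1, (l2 ++ m1), m2. repeat (rewrite <- app_assoc; simpl). reflexivity.
  - intros c1 a b Hc1 Ha Hb Hcand. destruct Hc1 as [<-|Hc1].
    + apply is_idle_Idle in Hb. unfold candidate in Hcand. rewrite Hb in Hcand. exact Hcand.
    (* Either [b] was a candidate before, or it has just seen an open door; but [a] has returned
       [true], so the door is closed. *)
    + destruct (proj2 (proj2 (Htr b)) Hcand) as [Hcand'|Hd].
      * exact (H5 c1 a b Hc1 Ha Hb Hcand').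
      * apply (H6 c1 a true Hc1) in Ha. destruct (inv_door _ _ _ _ H1) as [_ Hd'].
        exact (Hd' a Ha Hd).
  - intros c1 a r [<-|Hc1] Ha; [exact Ha|]. apply Htr. eauto.
Qed.

Lemma ninvoked_le (c : Config pstate) : (ninvoked pstate n c <= n)%nat.
Proof.
  unfold ninvoked. rewrite filter_length_le. rewrite length_seq. auto.
Qed.

Lemma reachable_history h :
  reachable (ratrace L) n n h -> exists c h' g dl, h = c :: h' /\ history_inv c h' g dl.
Proof.
  induction 1 as [|c h ch w c' Hr IH Hin Hw].
  - exists (init_config (ratrace L)), [], init_ghost, []. split; [reflexivity|].
    split; try (intros c1 a b [<-|[]]; discriminate); try (intros c1 a r [<-|[]]; discriminate).
    + apply inv_init.
    + constructor.
    + intros p. simpl. split; [tauto|discriminate].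
  - destruct IH as (c0 & h' & g & dl & E & HI). injection E as <- <-.
    destruct (good_step_all n L HL HnL n c g ch (hist_inv _ _ _ _ HI) (ninvoked_le c))
      as (l & Hl & Hall & _).
    change (st (ratrace L)) with pstate in *.
    rewrite Hl in Hin. apply in_map_iff in Hin as ([w' [c1 g1]] & E & Hin).
    simpl in E. injection E as -> ->. rewrite Forall_forall in Hall.
    destruct (Hall _ Hin) as (_ & HI' & Htr & _). simpl in HI', Htr.
    destruct (history_step c h g dl c' g1 HI HI' Htr) as [dl' H']. eauto 6.
Qed.

Lemma before_filter f l a b :
  f a = true -> f b = true -> before l a b -> before (filter f l) a b.
Proof.
  intros Ha Hb (l1 & l2 & l3 & ->). exists (filter f l1), (filter f l2), (filter f l3).
  rewrite filter_app. simpl. rewrite Ha, filter_app. simpl. rewrite Hb. reflexivity.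
Qed.

(** Chooses the operation to linearize first. If some process has returned [false], it is that one.
    Otherwise any candidate will do, and one exists because a returned [true] stems from a lost
    duel. *)
Lemma history_winner c h g dl p :
  history_inv c h g dl -> In p dl ->
  exists w, candidate (stat c) w /\ forall q, stat c q = Done false -> q = w.
Proof.
  intros HI Hp. destruct (classic (exists w, stat c w = Done false)) as [[w Hw]|Hno].
  - exists w. split; [unfold candidate; rewrite Hw; exact I|]. intros q Hq.
    eapply (winner_unique _ _ _ _ (inv_duel _ _ _ _ (hist_inv _ _ _ _ HI))); eauto.
  - apply (hist_done _ _ _ _ HI), is_done_Done in Hp as [[|] Hp]; [|exfalso; eauto].
    destruct (inv_candidate _ _ _ _ _ (hist_inv _ _ _ _ HI) Hp) as [w Hw].
    exists w. split; auto. intros q Hq. exfalso. eauto.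
Qed.

(** The order is the chosen [w], possibly still pending, followed by the other completed operations
    in the order of completion. *)
Lemma ratrace_linearizable : linearizable_impl (ratrace L) n.
Proof.
  intros h Hr c0 Hc0. destruct (reachable_history h Hr) as (c & h' & g & dl & -> & HI).
  injection Hc0 as <-. change (st (ratrace L)) with pstate in *.
  pose proof (hist_inv _ _ _ _ HI) as Hinv.
  destruct dl as [|p0 dl0] eqn:Edl.
  { exists []. split; [constructor|]. split; [|split; [|split]]; simpl; try tauto.
    intros p _ Hp. apply (hist_done _ _ _ _ HI) in Hp. exact Hp. }
  rewrite <- Edl in HI.
  destruct (history_winner _ _ _ _ p0 HI) as (w & Hw & Hwu); [subst; simpl; auto|]. clear Edl.
  set (f := fun p => negb (Nat.eqb p w)).
  assert (Hf : forall p, f p = true <-> p <> w).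
  { intros p. unfold f. rewrite negb_true_iff, Nat.eqb_neq. reflexivity. }
  assert (Hni : forall p, stat c p <> Idle -> (p < n)%nat /\ is_idle (stat c p) = false).
  { intros p Hp. split.
    - eapply local_nonidle; [apply (inv_local _ _ _ _ Hinv) | exact Hp].
    - destruct (stat c p); simpl; congruence. }
  exists (w :: filter f dl). split; [|split; [|split; [|split]]].
  - constructor; [|apply NoDup_filter, (hist_NoDup _ _ _ _ HI)].
    intros H. apply filter_In in H as [_ H]. apply Hf in H. congruence.
  - intros p _ Hp. apply (hist_done _ _ _ _ HI) in Hp. simpl.
    destruct (Nat.eq_dec w p); [auto|]. right. apply filter_In. split; auto. apply Hf. auto.
  - intros p [<-|Hp].
    + apply Hni. intros E. unfold candidate in Hw. rewrite E in Hw. exact Hw.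
    + apply Hni. apply filter_In in Hp as [Hp _]. apply (hist_done _ _ _ _ HI) in Hp.
      intros E. rewrite E in Hp. discriminate.
  - intros a b Ha Hb (c1 & Hc1 & Had & Hbi).
    assert (Hab : a <> b) by (intros ->; destruct (stat c1 b); discriminate).
    destruct Hb as [<-|Hb].
    (* Nobody completes before [w] is invoked: after a [true], latecomers never become candidates,
       and a [false] would come from [w] itself. *)
    + exfalso. apply is_done_Done in Had as [[|] Had].
      * exact (hist_candidate _ _ _ _ HI c1 a w Hc1 Had Hbi Hw).
      * apply Hab, Hwu. exact (hist_persist _ _ _ _ HI c1 a false Hc1 Had).
    + destruct Ha as [<-|Ha].
      * apply in_split in Hb as (l2 & l3 & E). exists [], l2, l3. rewrite E. reflexivity.
      * apply filter_In in Ha as [_ Ha]. apply filter_In in Hb as [Hb Hfb].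
        destruct (before_filter f dl a b Ha Hfb (hist_before _ _ _ _ HI c1 a b Hc1 Had Hbi Hb))
          as (l1 & l2 & l3 & E).
        exists (w :: l1), l2, l3. rewrite E. reflexivity.
  - intros p r Hp Hpr. simpl. split.
    + intros ->. rewrite (Hwu p Hpr). reflexivity.
    + intros E. injection E as ->. unfold candidate in Hw. rewrite Hpr in Hw.
      destruct r; [contradiction|reflexivity].
Qed.

End Linearizability.

(** * Conclusion *)

Lemma pow_1_01_exp (m : nat) : 1.01 ^ m = exp (INR m * ln 1.01).
Proof. rewrite <- Rpower_pow by lra. reflexivity. Qed.

Lemma ln_1_01_pos : 0 < ln 1.01.
Proof. rewrite <- ln_1. apply ln_increasing; lra. Qed.

Section Bounds.
Variables n L k : nat.
Hypothesis HL : (1 <= L)%nat.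
Hypothesis HnL : (n <= 2 ^ L)%nat.
Hypothesis Hk : (1 <= k)%nat.

Lemma INR_k_ge_1 : 1 <= INR k.
Proof. apply le_INR in Hk. exact Hk. Qed.

Lemma ln_k_nonneg : 0 <= ln (INR k).
Proof.
  pose proof INR_k_ge_1. rewrite <- ln_1. destruct (Req_dec (INR k) 1) as [->|]; [lra|].
  left. apply ln_increasing; lra.
Qed.

Lemma pot_budget : 1 + 6 * INR k ^ 2 <= 7 * exp (2 * ln (INR k)).
Proof.
  pose proof INR_k_ge_1. replace (2 * ln (INR k)) with (ln (INR k) + ln (INR k)) by ring.
  rewrite exp_plus, exp_ln by lra. nra.
Qed.

(** In place of Jensen's inequality for the logarithm, the tangent bound [1 + y <= exp y] at
    [y = m * l - 2 * x] bounds the maximum [m] by an affine function of [1.01 ^ m]. *)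
Lemma ratrace_exp_maxsteps (A : Adversary (ratrace L)) (t : nat) :
  exp_maxsteps (ratrace L) n k A t <= 7 / ln 1.01 * (1 + ln (INR k)).
Proof.
  pose proof ln_1_01_pos as Hl. set (l := ln 1.01) in *. set (x := ln (INR k)).
  assert (Hx : 0 <= x) by apply ln_k_nonneg.
  assert (Hb : 0 <= exp (- (2 * x)) / l)
    by (apply Rmult_le_pos; [left; apply exp_pos | left; apply Rinv_0_lt_compat; exact Hl]).
  unfold exp_maxsteps.
  (* The weight [exp (- (2 * x)) / l] cancels the budget [7 * exp (2 * x)] and leaves [7 / l]. *)
  eapply Rle_trans; [apply (expect_init_le n L HL HnL k A t _ (2 * x / l) (exp (- (2 * x)) / l)); auto|].
  - intros c h. unfold cur_maxsteps. cbn [hd]. change (st (ratrace L)) with pstate.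
    set (m := maxsteps pstate n c). rewrite pow_1_01_exp. fold l.
    replace (exp (- (2 * x)) / l * exp (INR m * l)) with (exp (INR m * l - 2 * x) / l)
      by (unfold Rminus; rewrite exp_plus; unfold Rdiv; ring).
    apply Rmult_le_reg_l with l; [exact Hl|].
    replace (l * (2 * x / l + exp (INR m * l - 2 * x) / l))
      with (2 * x + exp (INR m * l - 2 * x)) by (field; lra).
    pose proof (exp_ineq1_le (INR m * l - 2 * x)). lra.
  - assert (H : exp (- (2 * x)) / l * (1 + 6 * INR k ^ 2) <= 7 / l).
    { apply Rle_trans with (exp (- (2 * x)) / l * (7 * exp (2 * x))).
      - apply Rmult_le_compat_l; [exact Hb|]. apply pot_budget.
      - right. rewrite exp_Ropp. pose proof (exp_pos (2 * x)). field. split; lra. }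
    assert (H2 : 2 * x / l <= 7 / l * x).
    { replace (7 / l * x) with (7 * x / l) by (field; lra).
      apply Rmult_le_compat_r; [left; apply Rinv_0_lt_compat; exact Hl|lra]. }
    lra.
Qed.

(** Markov's inequality, written as a pointwise bound on minus the indicator. At the threshold [B]
    the moment [1.01 ^ m] is [exp (6 * (1 + x))]. *)
Lemma ratrace_prob_maxsteps (A : Adversary (ratrace L)) (t : nat) :
  1 - Rpower (INR k) (- (1)) <=
  prob_maxsteps_le (ratrace L) n k A t (6 / ln 1.01 * (1 + ln (INR k))).
Proof.
  pose proof ln_1_01_pos as Hl. set (l := ln 1.01) in *. set (x := ln (INR k)).
  assert (Hx : 0 <= x) by apply ln_k_nonneg.
  set (B := 6 / l * (1 + x)).
  unfold prob_maxsteps_le.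
  set (f := fun h => if Rle_dec (INR (cur_maxsteps (ratrace L) n h)) B then 1 else 0).
  assert (H : expect (ratrace L) n k A t (fun h => - f h) [init_config (ratrace L)] <=
              -1 + exp (- (6 * (1 + x))) * (1 + 6 * INR k ^ 2)).
  { apply expect_init_le; auto; [left; apply exp_pos|].
    intros c h. unfold f, cur_maxsteps. cbn [hd]. change (st (ratrace L)) with pstate.
    set (m := maxsteps pstate n c). rewrite pow_1_01_exp. fold l. rewrite <- exp_plus.
    destruct (Rle_dec (INR m) B) as [Hm|Hm].
    - pose proof (exp_pos (- (6 * (1 + x)) + INR m * l)). lra.
    - assert (Hm' : 6 * (1 + x) <= INR m * l).
      { replace (6 * (1 + x)) with (B * l) by (unfold B; field; lra).
        apply Rmult_le_compat_r; lra. }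
      pose proof (exp_ineq1_le (- (6 * (1 + x)) + INR m * l)). lra. }
  rewrite expect_opp in H.
  (* [exp 6] absorbs the constant 7, and the exponent that remains is [-4 * x], which is at most
     [- x]. *)
  assert (H7 : exp (- (6 * (1 + x))) * (1 + 6 * INR k ^ 2) <= exp (- x)).
  { apply Rle_trans with (exp (- (6 * (1 + x))) * (exp 6 * exp (2 * x))).
    - apply Rmult_le_compat_l; [left; apply exp_pos|].
      apply Rle_trans with (7 * exp (2 * x)); [apply pot_budget|].
      apply Rmult_le_compat_r; [left; apply exp_pos|]. pose proof (exp_ineq1_le 6). lra.
    - rewrite <- !exp_plus.
      destruct (Req_dec x 0) as [Hx0|Hx0]; [right; f_equal; rewrite Hx0; ring|].
      left. apply exp_increasing. lra. }
  unfold Rpower. replace (- (1) * ln (INR k)) with (- x) by (unfold x; ring). lra.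
Qed.

End Bounds.

Theorem theorem6 :
  exists (Creg1 Creg2 Cexp Cwhp c : R),
    0 < Creg1 /\ 0 < c /\
    forall n : nat, (1 <= n)%nat ->
    exists I : Impl,
      valid_impl I /\
      Creg1 * INR n <= INR (nregs I) <= Creg2 * INR n /\
      linearizable_impl I n /\
      forall k : nat, (1 <= k <= n)%nat ->
      forall (A : Adversary I) (t : nat),
        exp_maxsteps I n k A t <= Cexp * (1 + ln (INR k)) /\
        1 - Rpower (INR k) (- c) <= prob_maxsteps_le I n k A t (Cwhp * (1 + ln (INR k))).
Proof.
  (* The register count is [16 * 2 ^ L + 8], at most [32 * n + 8], hence at most [40 * n]. *)
  exists 1, 40, (7 / ln 1.01), (6 / ln 1.01), 1. split; [lra|]. split; [lra|].
  (* This depth gives [n < 2 ^ L <= 2 * n] and is at least 1. *)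
  intros n Hn. set (L := S (Nat.log2 n)). exists (ratrace L).
  pose proof (Nat.log2_spec n ltac:(lia)) as [Hlo Hhi]. fold L in Hhi.
  assert (HL : (1 <= L)%nat) by (unfold L; lia).
  assert (HL2 : (2 ^ L <= 2 * n)%nat) by (unfold L; rewrite Nat.pow_succ_r'; lia).
  split; [apply ratrace_valid|]. split; [|split].
  - cbn [nregs ratrace]. unfold register_count. rewrite Nat.pow_succ_r'. split.
    + rewrite Rmult_1_l. apply le_INR. lia.
    + replace 40 with (INR 40) by (simpl; lra). rewrite <- mult_INR. apply le_INR. lia.
  - apply ratrace_linearizable; lia.
  - intros k Hk A t. split.
    + apply ratrace_exp_maxsteps; lia.
    + apply ratrace_prob_maxsteps; lia.
Qed.
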